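(* The volume of each Meissner tetrahedron is $$\pi\left[\frac{2}{3}-\frac{\sqrt{3}}{4}\cos^{-1}(1/3)\right].$$
   Context: $B(x)$ denotes the closed ball of radius one centered at $x\in\mathbb{R}^3$, and $B(S)=\bigcap_{x\in S}B(x)$ for $S\subset\mathbb{R}^3$. Let $a_1,a_2,a_3,a_4\in\mathbb{R}^3$ satisfy $|a_i-a_j|=1$ for $i\ne j$, and let $R=B(\{a_1,a_2,a_3,a_4\})$ be the associated Reuleaux tetrahedron. For $\{i,j,k,l\}=\{1,2,3,4\}$, $e_{ij}$ denotes the edge of $R$ joining $a_i$ and $a_j$, i.e. the circular arc $\partial B(a_k)\cap\partial B(a_l)\cap R$ with endpoints $a_i,a_j$. There are, up to congruence, two Meissner tetrahedra: the one in which the smoothed edges share a common face, $B(e_{12}\cup e_{13}\cup e_{14})$, and the one in which the smoothed edges share a common vertex, $B(\{a_1\}\cup e_{23}\cup e_{24}\cup e_{34})$. *)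

(* Defs.v *)
From HB Require Import structures.
From mathcomp Require Import all_boot all_order all_algebra.
From mathcomp Require Import all_classical all_reals all_analysis.
Set Implicit Arguments.
Unset Strict Implicit.
Unset Printing Implicit Defensive.
Import Order.TTheory GRing.Theory Num.Theory.
Import numFieldNormedType.Exports.
Local Open Scope classical_set_scope.
Local Open Scope ring_scope.

(* Three-dimensional space is R * R * R, which carries the product topology and
   the product of the Borel sigma-algebras.  Its library norm `|x| is the
   sup norm, hence the separate Euclidean norm. *)
Definition enorm (R : realType) (x : R * R * R) : R :=
  Num.sqrt (x.1.1 ^+ 2 + x.1.2 ^+ 2 + x.2 ^+ 2).

Definition volume (R : realType) (A : set (R * R * R)) : \bar R :=
  ((@lebesgue_measure R \x @lebesgue_measure R) \x @lebesgue_measure R)%E A.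

Definition unit_ball (R : realType) (x : R * R * R) : set (R * R * R) :=
  [set y | enorm (y - x) <= 1].

Definition ball_inter (R : realType) (S : set (R * R * R)) : set (R * R * R) :=
  \bigcap_(x in S) unit_ball x.

Definition boundary (T : topologicalType) (A : set T) : set T :=
  closure A `\` interior A.

Definition unit_tetrahedron (R : realType) (a : 'I_4 -> R * R * R) : Prop :=
  forall i j : 'I_4, i != j -> enorm (a i - a j) = 1.

Definition reuleaux (R : realType) (a : 'I_4 -> R * R * R) : set (R * R * R) :=
  ball_inter (range a).

(* For i != j, exactly two indices k, l remain, and the intersection below is
   boundary B(a_k) `&` boundary B(a_l) `&` reuleaux a, the circular arc from
   a_i to a_j. *)
Definition edge (R : realType) (a : 'I_4 -> R * R * R) (i j : 'I_4) :
    set (R * R * R) :=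
  (\bigcap_(k in [set k : 'I_4 | k != i /\ k != j]) boundary (unit_ball (a k)))
    `&` reuleaux a.

(* The vertices a_1, a_2, a_3, a_4 are a 0, a 1, a 2, a 3. *)
Definition meissner_face (R : realType) (a : 'I_4 -> R * R * R) :
    set (R * R * R) :=
  ball_inter (edge a 0 1 `|` edge a 0 2 `|` edge a 0 3).

Definition meissner_vertex (R : realType) (a : 'I_4 -> R * R * R) :
    set (R * R * R) :=
  ball_inter ([set a 0] `|` edge a 1 2 `|` edge a 1 3 `|` edge a 2 3).

(* Main.v *)
Require Import Defs.
From HB Require Import structures.
From mathcomp Require Import all_boot all_order all_algebra.
From mathcomp Require Import all_classical all_reals all_analysis.
From mathcomp Require Import measurable_realfun ring lra.
Set Implicit Arguments.
Unset Strict Implicit.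
Unset Printing Implicit Defensive.
Import Order.TTheory GRing.Theory Num.Theory.
Import numFieldNormedType.Exports.
Local Open Scope classical_set_scope.
Local Open Scope ring_scope.

(* A unit ball intersection cut by the four face planes of the tetrahedron splits
   into the tetrahedron, four caps (balls over a face) and six edge regions (the
   points beyond two faces); nothing of it lies beyond three faces.  Writing b_i
   for the barycentric coordinates and e2 for their second elementary symmetric
   function, the squared distance to vertex i is 1 - b_i - e2, so this is pure
   algebra.  Requiring distance at most 1 from the arc e_kl only changes the region
   beyond the opposite edge a_i a_j, where the farthest point of the arc lies in
   the plane through the point and the axis a_i a_j: the region becomes a wedge,
   of angle acos (1/3), of the solid obtained by rotating a circular arc about its
   chord a_i a_j.  Both Meissner bodies have three smoothed and three sharp edges,
   hence the same volume.  The tetrahedron with one cap is a cone over a spherical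
   triangle, measured by Girard's inclusion-exclusion; the edge regions are
   measured by slicing.  All regions are described by distances to the vertices,
   so that rigid motions reduce each of them to coordinates adapted to it. *)

(** * Slicing areas and volumes *)

(** Caps and sharp edge regions contribute [sqrt 2] and bare multiples of the dihedral angle, which
    are absent from the result. Together with the tetrahedron they cancel exactly when three of the
    six edges are smoothed; the product of [pi] and the angle then comes from the smoothed edges
    alone. Two shapes resist direct slicing. For a cap, Girard's argument replaces it by a ball, a
    lune and a tetrahedron, whose slices are disks, sectors and rectangles. A sharp edge region is
    bounded by two spheres, but its symmetry plane halves it into pieces bounded by only one of
    them, with circular segments as slices. The far side of a face is given by a strict inequality,
    so that the regions are disjoint; where a motion or a computation exchanges strict and weak
    inequalities, the face planes are discarded as null sets. *)

Lemma measurable_ltr_set d (T : measurableType d) (R : realType)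
    (f g : T -> R) :
  measurable_fun setT f -> measurable_fun setT g ->
  measurable [set x | f x < g x].
Proof.
move=> mf mg; rewrite -[X in measurable X]setTI.
exact: (measurable_fun_ltr mf mg) measurableT [set true] _.
Qed.

Lemma measurable_ler_set d (T : measurableType d) (R : realType)
    (f g : T -> R) :
  measurable_fun setT f -> measurable_fun setT g ->
  measurable [set x | f x <= g x].
Proof.
move=> mf mg; rewrite -[X in measurable X]setTI.
exact: (measurable_fun_ler mf mg) measurableT [set true] _.
Qed.

(* The library's sigma-finite instance of [m1 \x m2] is shadowed by the one for
   products of probabilities, so the plane area gets its own constant. *)
Section area.
Variable R : realType.
Local Notation mu := (@lebesgue_measure R).
Local Notation TR := (measurableTypeR R).

Definition area : set (TR * TR) -> \bar R := (mu \x mu)%E.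

HB.instance Definition _ := Measure.copy area (mu \x mu)%E.

Let area_sigma_finite : sigma_finite setT area.
Proof.
have /sigma_finiteP[F [TF ndF Foo]] := sigma_finiteT mu.
exists (fun n => F n `*` F n) => [|n].
  rewrite -setXTT TF predeqE => -[x y]; split => [[/= [n _ Fn] [k _ Fk]]|].
    exists (maxn n k) => //; split.
      by move: x Fn; exact/subsetPset/ndF/leq_maxl.
    by move: y Fk; exact/subsetPset/ndF/leq_maxr.
  by move=> [n _ []/= ? ?]; split; exists n.
have [mFn Fnoo] := Foo n; split; first exact: measurableX.
by rewrite /area product_measure1E// lte_mul_pinfty// ge0_fin_numE.
Qed.

HB.instance Definition _ := Measure_isSigmaFinite.Build _ _ _ area
  area_sigma_finite.

End area.

Section slices.
Variable R : realType.
Local Notation mu := (@lebesgue_measure R).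
Local Notation TR := (measurableTypeR R).

Lemma mu_translate (c : R) (A : set R) : measurable A ->
  mu [set x | A (x + c)] = mu A.
Proof.
move=> mA.
pose f : _ -> measurableTypeR R := fun x : R => x + c.
have mf : measurable_fun setT f by exact: measurable_funD.
apply/esym; transitivity (pushforward mu f A) => //.
apply: lebesgue_measure_unique => // _ [[a b] _ <-].
move=> {mA A}; rewrite [RHS](_ : _ = mu `]a - c, b - c]%classic); last first.
  congr (mu _).
  by apply/seteqP; split => x /=; rewrite !in_itv /= /f ltrBlDr lerBrDr.
rewrite /= !lebesgue_measure_itv /= !lte_fin ltrD2r.
by case: ifP => // _; rewrite -!EFinB; congr (_%:E); ring.
Qed.

Lemma area_slice (B : set (R * R)) : measurable B ->
  area B = (\int[mu]_x mu [set y | B (x, y)])%E.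
Proof.
move=> mB; apply: eq_integral => x _ /=; congr (mu _).
by apply/seteqP; split => y /=; rewrite /xsection /= inE.
Qed.

(** [area] is by definition an integral over vertical sections; slicing the other way is Tonelli,
    obtained from the uniqueness of the product measure. *)
Lemma area_slice2 (B : set (R * R)) : measurable B ->
  area B = (\int[mu]_y mu [set x | B (x, y)])%E.
Proof.
move=> mB; transitivity ((mu \x^ mu)%E B).
  apply: (@product_measure_unique _ _ TR TR R mu mu (mu \x^ mu)%E) => //.
  by move=> C D mC mD; exact: product_measure2E.
apply: eq_integral => x _ /=; congr (mu _).
by apply/seteqP; split => y /=; rewrite /ysection /= inE.
Qed.

Lemma volume_slice (A : set (R * R * R)) : measurable A ->
  volume A = (\int[mu]_z area [set p | A (p, z)])%E.
Proof.
move=> mA; transitivity ((@area R \x^ mu)%E A).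
  apply: (@product_measure_unique _ _ (TR * TR)%type TR R (@area R) mu
    (@area R \x^ mu)%E) => //.
  by move=> B C mB mC; exact: product_measure2E.
apply: eq_integral => x _ /=; congr (area _).
by apply/seteqP; split => y /=; rewrite /ysection /= inE.
Qed.

Lemma volume_slice_col (A : set (R * R * R)) : measurable A ->
  volume A = (\int[@area R]_p mu [set z | A (p, z)])%E.
Proof.
move=> mA; apply: eq_integral => x _ /=; congr (mu _).
by apply/seteqP; split => y /=; rewrite /xsection /= inE.
Qed.

End slices.

(** * The fundamental theorem of calculus on slices *)

Section acosc.
Variable R : realType.
Implicit Types x : R.

(** Clamping the argument makes [acos] continuous on the whole line, so that the primitives below
    are continuous also at the ends of their intervals. *)
Definition clamp x : R := Num.max (-1) (Num.min x 1).

Definition acosc x : R := acos (clamp x).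

Lemma clamp_itv x : -1 <= clamp x <= 1.
Proof. by rewrite /clamp le_max lexx /= ge_max ge_min lexx orbT andbT; lra. Qed.

Lemma clamp_id x : -1 <= x <= 1 -> clamp x = x.
Proof. by move=> /andP[? ?]; rewrite /clamp (min_idPl _) // (max_idPr _). Qed.

Lemma acosc_acos x : -1 <= x <= 1 -> acosc x = acos x.
Proof. by move=> h; rewrite /acosc clamp_id. Qed.

(** On [-1, 1], [acos] is continuous as the inverse of the continuous [cos] on [0, pi], and [clamp]
    is continuous with values there. *)
Lemma continuous_acosc : continuous acosc.
Proof.
move=> x.
have cacos : {within `[(-1), 1], continuous (@acos R)}.
  have := @segment_can_continuous R 0 pi (@cos R) (@acos R).
  rewrite cos0 cospi (min_idPr _) ?(max_idPl _); [|lra|lra]; apply.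
  - exact: pi_ge0.
  - by apply: continuous_subspaceT => y; exact: continuous_cos.
  - exact: cosK.
have cclamp : {for x, continuous clamp}.
  apply: (@continuous_max _ _ (cst (-1)) (fun x => Num.min x 1)).
    exact: cvg_cst.
  apply: (@continuous_min _ _ (fun x => x) (cst 1)); first exact: cvg_id.
  exact: cvg_cst.
move/subspace_continuousP : cacos => /(_ (clamp x)).
rewrite /= in_itv /= clamp_itv => /(_ isT) H.
have {}H : acos y @[y --> within [set y | -1 <= y <= 1] (nbhs (clamp x))]
    --> acos (clamp x) by move: H; under eq_set do rewrite /= in_itv /=.
move=> U /H /= HU; have {}HU : nbhs x [set y | -1 <= clamp y <= 1 ->
  U (acos (clamp y))].
  exact: cclamp _ HU.
by apply: filterS HU => y; apply; exact: clamp_itv.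
Qed.

Lemma is_derive_acosc x : -1 < x < 1 ->
  is_derive x 1 acosc (- (Num.sqrt (1 - x ^+ 2))^-1).
Proof.
move=> x1.
apply: near_eq_is_derive; last exact: is_derive1_acos.
have xi : x \in `]-1, 1[ by rewrite in_itv.
near=> y; rewrite acosc_acos //.
have : y \in `]-1, 1[ by near: y; exact: near_in_itvoo.
by rewrite in_itv /= => /andP[? ?]; rewrite !ltW.
Unshelve. all: by end_near.
Qed.

End acosc.

Section ftc.
Variable R : realType.
Local Notation mu := (@lebesgue_measure R).

(** The derivative is required only in the interior because the primitives contain roots and [acosc]
    at the ends of their smooth range. [ba] and [bb] leave each end open or closed, so that adjacent
    regions can be disjoint. *)
Lemma integral_FTC ba bb (h : R -> \bar R) (f F : R -> R) (a b : R) : a <= b ->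
  let I := Interval (BSide ba a) (BSide bb b) in
  (forall x, a <= x <= b -> {for x, continuous f}) ->
  (forall x, a <= x <= b -> {for x, continuous F}) ->
  (forall x, a < x < b -> is_derive x 1 F (f x)) ->
  (forall x, x \in I -> h x = (f x)%:E) ->
  (forall x, x \notin I -> h x = 0%E) ->
  (\int[mu]_x h x = (F b - F a)%:E)%E.
Proof.
move=> ab I cf cF dF hf h0.
have cfI : {within `[a, b], continuous f}.
  by apply: continuous_in_subspaceT => x; rewrite inE /= in_itv /=; exact: cf.
have mf : measurable_fun `[a, b] f.
  by apply: subspace_continuous_measurable_fun => //; exact: measurable_itv.
transitivity (\int[mu]_(x in [set` I]) (f x)%:E)%E.
  rewrite [RHS]integral_mkcond; apply: eq_integral => x _.
  rewrite patchE; case: ifPn => [/set_mem|/negP xI]; first exact: hf.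
  by apply/h0/negP => xI'; apply/xI/mem_set.
transitivity (\int[mu]_(x in `[a, b]) (f x)%:E)%E.
  have mfI ba' bb' : measurable_fun
      [set` Interval (BSide ba' a) (BSide bb' b)] (EFin \o f).
    apply/measurable_EFinP; apply: measurable_funS mf => //.
    by apply: subset_itv; rewrite bnd_simp; [case: ba'|case: bb'].
  rewrite /I; case: ba {I hf h0}.
    by case: bb => //; rewrite integral_itv_bndo_bndc.
  by case: bb; rewrite ?integral_itv_bndo_bndc // integral_itv_obnd_cbnd.
move: ab; rewrite le_eqVlt => /predU1P[<-|ab].
  by rewrite set_itv1 integral_set1 subrr.
rewrite (@continuous_FTC2 _ f F a b) //.
- split.
  + by move=> x; rewrite in_itv /= => /dF -[].
  + by apply: cvg_at_right_filter; apply: cF; rewrite lexx ltW.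
  + by apply: cvg_at_left_filter; apply: cF; rewrite lexx ltW.
- move=> x; rewrite in_itv /= => /dF dFx.
  by rewrite derive1E; exact: derive_val.
Qed.

Lemma volume_FTC ba bb (A : set (R * R * R)) (f F : R -> R) (a b : R) :
  measurable A -> a <= b -> let I := Interval (BSide ba a) (BSide bb b) in
  (forall x, a <= x <= b -> {for x, continuous f}) ->
  (forall x, a <= x <= b -> {for x, continuous F}) ->
  (forall x, a < x < b -> is_derive x 1 F (f x)) ->
  (forall z, z \in I -> area [set p | A (p, z)] = (f z)%:E) ->
  (forall z, z \notin I -> [set p | A (p, z)] = set0) ->
  volume A = (F b - F a)%:E.
Proof.
move=> mA ab I cf cF dF hf h0; rewrite volume_slice //.
by apply: integral_FTC cf cF dF hf _ => // z /h0 ->; rewrite measure0.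
Qed.

Lemma area_FTC ba bb (A : set (R * R)) (f F : R -> R) (a b : R) :
  measurable A -> a <= b -> let I := Interval (BSide ba a) (BSide bb b) in
  (forall x, a <= x <= b -> {for x, continuous f}) ->
  (forall x, a <= x <= b -> {for x, continuous F}) ->
  (forall x, a < x < b -> is_derive x 1 F (f x)) ->
  (forall x, x \in I -> mu [set y | A (x, y)] = (f x)%:E) ->
  (forall x, x \notin I -> [set y | A (x, y)] = set0) ->
  area A = (F b - F a)%:E.
Proof.
move=> mA ab I cf cF dF hf h0; rewrite area_slice //.
by apply: integral_FTC cf cF dF hf _ => // z /h0 ->; rewrite measure0.
Qed.

End ftc.

(** * Syntax-directed rules for continuity, derivatives and measurability *)

Section lambda_rules.
Variable R : realType.
Implicit Types (f g : R -> R) (x k : R).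

Definition cont_at x f : Prop := {for x, continuous f}.

Lemma contC x k : cont_at x (fun _ : R => k).
Proof. exact: cvg_cst. Qed.

Lemma contI x : cont_at x (fun y : R => y).
Proof. exact: cvg_id. Qed.

Lemma contD f g x : cont_at x f -> cont_at x g ->
  cont_at x (fun y => f y + g y).
Proof. by move=> cf cg; exact: cvgD. Qed.

Lemma contN f x : cont_at x f -> cont_at x (fun y => - f y).
Proof. by move=> cf; exact: cvgN. Qed.

Lemma contM f g x : cont_at x f -> cont_at x g ->
  cont_at x (fun y => f y * g y).
Proof. by move=> cf cg; exact: cvgM. Qed.

Lemma contX f x n : cont_at x f ->
  cont_at x (fun y => f y ^+ n).
Proof.
move=> cf; apply: (@continuous_comp _ _ _ f (fun y => y ^+ n) x cf).
exact: exprn_continuous.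
Qed.

Lemma contV f x : f x != 0 -> cont_at x f ->
  cont_at x (fun y => (f y)^-1).
Proof. by move=> fx0 cf; exact: cvgV. Qed.

Lemma cont_sqrt f x : cont_at x f ->
  cont_at x (fun y => Num.sqrt (f y)).
Proof. by move=> cf; apply: (@continuous_comp _ _ _ f (@Num.sqrt R) x cf);
  exact: sqrt_continuous. Qed.

Lemma cont_acosc f x : cont_at x f ->
  cont_at x (fun y => acosc (f y)).
Proof. by move=> cf; apply: (@continuous_comp _ _ _ f (@acosc R) x cf); exact:
  continuous_acosc. Qed.

Lemma cont_atan f x : cont_at x f ->
  cont_at x (fun y => atan (f y)).
Proof. by move=> cf; apply: (@continuous_comp _ _ _ f (@atan R) x cf); exact:
  continuous_atan. Qed.

(* Opaque to type class resolution, which otherwise solves derivative goals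
   eagerly and in an uncontrolled form. *)
Definition has_deriv x f (df : R) : Prop := is_derive x 1 f df.

Lemma is_derive_has_deriv x f df df' :
  has_deriv x f df' -> df' = df -> is_derive x 1 f df.
Proof. by move=> ? <-. Qed.

Lemma has_derivC x k : has_deriv x (fun _ : R => k) 0.
Proof. exact: is_derive_cst. Qed.

Lemma has_derivI x : has_deriv x (fun y : R => y) 1.
Proof. exact: is_derive_id. Qed.

Lemma has_derivD f g x df dg : has_deriv x f df -> has_deriv x g dg ->
  has_deriv x (fun y => f y + g y) (df + dg).
Proof. exact: is_deriveD. Qed.

Lemma has_derivN f x df : has_deriv x f df ->
  has_deriv x (fun y => - f y) (- df).
Proof. exact: is_deriveN. Qed.

Lemma has_derivM f g x df dg : has_deriv x f df -> has_deriv x g dg ->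
  has_deriv x (fun y => f y * g y) (f x * dg + g x * df).
Proof. exact: is_deriveM. Qed.

Lemma has_derivX f x df n : has_deriv x f df ->
  has_deriv x (fun y => f y ^+ n) (n%:R * f x ^+ n.-1 * df).
Proof.
move=> dfx; rewrite (_ : (fun y => _) = f ^+ n); first exact: is_deriveX.
by apply/funext => y; rewrite fctE.
Qed.

Lemma has_deriv_sqrt f x df : 0 < f x -> has_deriv x f df ->
  has_deriv x (fun y => Num.sqrt (f y)) ((2 * Num.sqrt (f x))^-1 * df).
Proof.
by move=> fx0 dfx; apply: is_derive1_comp => //; exact: is_derive1_sqrt.
Qed.

Lemma has_deriv_inv f x df : f x != 0 -> has_deriv x f df ->
  has_deriv x (fun y => (f y)^-1) (- (f x) ^- 2 * df).
Proof. by move=> fx0 dfx; apply: is_deriveV. Qed.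

Lemma has_deriv_acosc f x df : -1 < f x < 1 -> has_deriv x f df ->
  has_deriv x (fun y => acosc (f y)) (- (Num.sqrt (1 - f x ^+ 2))^-1 * df).
Proof.
by move=> fx0 dfx; apply: is_derive1_comp => //; exact: is_derive_acosc.
Qed.

Lemma has_deriv_atan f x df : has_deriv x f df ->
  has_deriv x (fun y => atan (f y)) ((1 + f x ^+ 2)^-1 * df).
Proof. by move=> dfx; apply: is_derive1_comp. Qed.

End lambda_rules.

(** The rules match syntactic lambdas; the last four cases expand eta-reduced functions such as
    [GRing.mul k] before matching again. *)
Ltac cont_at := lazymatch goal with
  | |- cont_at _ (fun _ => ?k) => exact: contC
  | |- cont_at _ (fun y => y) => exact: contI
  | |- cont_at _ (fun y => @?f y + @?g y) => apply: contD; cont_at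
  | |- cont_at _ (fun y => - (@?f y)) => apply: contN; cont_at
  | |- cont_at _ (fun y => (@?f y) ^+ _) => apply: contX; cont_at
  | |- cont_at _ (fun y => @?f y * @?g y) => apply: contM; cont_at
  | |- cont_at _ (fun y => (@?f y)^-1) => apply: contV; [|cont_at]
  | |- cont_at _ (fun y => Num.sqrt (@?f y)) => apply: cont_sqrt; cont_at
  | |- cont_at _ (fun y => acosc (@?f y)) => apply: cont_acosc; cont_at
  | |- cont_at _ (fun y => atan (@?f y)) => apply: cont_atan; cont_at
  | |- cont_at ?x (GRing.mul ?k) =>
      change (cont_at x (fun y => k * y)); cont_at
  | |- cont_at ?x (GRing.add ?k) =>
      change (cont_at x (fun y => k + y)); cont_at
  | |- cont_at ?x (GRing.opp) =>
      change (cont_at x (fun y => - y)); cont_at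
  | |- cont_at ?x (Num.sqrt) =>
      change (cont_at x (fun y => Num.sqrt y)); cont_at
  end.

Ltac cont := match goal with |- {for ?x, continuous ?f} =>
  change (cont_at x f) end; cont_at.

Ltac has_deriv := lazymatch goal with
  | |- has_deriv _ (fun _ => ?k) _ => exact: has_derivC
  | |- has_deriv _ (fun y => y) _ => exact: has_derivI
  | |- has_deriv _ (fun y => @?f y + @?g y) _ => apply: has_derivD; has_deriv
  | |- has_deriv _ (fun y => - (@?f y)) _ => apply: has_derivN; has_deriv
  | |- has_deriv _ (fun y => (@?f y) ^+ _) _ => apply: has_derivX; has_deriv
  | |- has_deriv _ (fun y => @?f y * @?g y) _ => apply: has_derivM; has_deriv
  | |- has_deriv _ (fun y => (@?f y)^-1) _ => apply: has_deriv_inv; [|has_deriv]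
  | |- has_deriv _ (fun y => Num.sqrt (@?f y)) _ => apply: has_deriv_sqrt;
    [|has_deriv]
  | |- has_deriv _ (fun y => acosc (@?f y)) _ => apply: has_deriv_acosc;
    [|has_deriv]
  | |- has_deriv _ (fun y => atan (@?f y)) _ => apply: has_deriv_atan; has_deriv
  | |- has_deriv ?x (GRing.mul ?k) ?d =>
      change (has_deriv x (fun y => k * y) d); has_deriv
  | |- has_deriv ?x (GRing.add ?k) ?d =>
      change (has_deriv x (fun y => k + y) d); has_deriv
  | |- has_deriv ?x (GRing.opp) ?d =>
      change (has_deriv x (fun y => - y) d); has_deriv
  | |- has_deriv ?x (Num.sqrt) ?d =>
      change (has_deriv x (fun y => Num.sqrt y) d); has_deriv
  end.

Ltac deriv := apply: is_derive_has_deriv; [has_deriv|].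

Lemma measurable_sqrt d (T : measurableType d) (R : realType) (f : T -> R) :
  measurable_fun setT f -> measurable_fun setT (fun x => Num.sqrt (f x)).
Proof.
move=> mf; apply: (measurableT_comp _ mf).
by apply: continuous_measurable_fun; exact: sqrt_continuous.
Qed.

Ltac meas_fun := lazymatch goal with
  | |- measurable_fun _ (fun _ => ?k) => exact: measurable_cst
  | |- measurable_fun _ (fun p => p) => exact: measurable_id
  | |- measurable_fun _ fst => exact: measurable_fst
  | |- measurable_fun _ snd => exact: measurable_snd
  | |- measurable_fun _ (fun p => @fst _ _ p) => exact: measurable_fst
  | |- measurable_fun _ (fun p => @snd _ _ p) => exact: measurable_snd
  | |- measurable_fun _ (fun p => @fst _ _ (@fst _ _ p)) =>
      exact: (measurableT_comp measurable_fst measurable_fst)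
  | |- measurable_fun _ (fun p => @snd _ _ (@fst _ _ p)) =>
      exact: (measurableT_comp measurable_snd measurable_fst)
  | |- measurable_fun _ (fun p => @?f p + - (@?g p)) =>
      apply: measurable_funB; meas_fun
  | |- measurable_fun _ (fun p => @?f p + @?g p) =>
      apply: measurable_funD; meas_fun
  | |- measurable_fun _ (fun p => - (@?f p)) => apply: measurable_funN; meas_fun
  | |- measurable_fun _ (fun p => (@?f p) ^+ _) =>
      apply: measurable_funX; meas_fun
  | |- measurable_fun _ (fun p => @?f p * @?g p) =>
      apply: measurable_funM; meas_fun
  | |- measurable_fun _ (fun p => Num.sqrt (@?f p)) =>
      apply: measurable_sqrt; meas_fun
  end.

Ltac meas := lazymatch goal with
  | |- measurable (mkset (fun p => @?A p /\ @?B p)) =>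
      apply: (@measurableI _ _ (mkset A) (mkset B)); meas
  | |- measurable (mkset (fun p => @?A p \/ @?B p)) =>
      apply: (@measurableU _ _ (mkset A) (mkset B)); meas
  | |- measurable (mkset (fun p => is_true (@Order.le _ _ (@?f p) (@?g p)))) =>
      apply: (@measurable_ler_set _ _ _ f g); meas_fun
  | |- measurable (mkset (fun p => is_true (@Order.lt _ _ (@?f p) (@?g p)))) =>
      apply: (@measurable_ltr_set _ _ _ f g); meas_fun
  end.

(** * Circular segments *)

Section segment.
Variable R : realType.
Local Notation mu := (@lebesgue_measure R).

(** The part of a disk beyond a chord at signed distance [d] from the center: a sector of half-angle
    [acos (d / r)] minus a triangle whose signed area is negative for [d < 0]. *)
Definition segment_area (r d : R) : R :=
  r ^+ 2 * acosc (d / r) - d * Num.sqrt (r ^+ 2 - d ^+ 2).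

Lemma sqr_ler_sqrt (y a : R) : (y ^+ 2 <= a) =
  (0 <= a) && (- Num.sqrt a <= y <= Num.sqrt a).
Proof.
have [a0|a0] /= := leP 0 a; last first.
  by apply/negbTE; rewrite -ltNge (lt_le_trans a0) ?sqr_ge0.
by rewrite -ler_norml -{1}(sqr_sqrtr a0) -(real_normK (num_real y))
  ler_sqr ?nnegrE ?sqrtr_ge0.
Qed.

Lemma mu_sqr_le (a : R) : 0 <= a ->
  mu [set y | y ^+ 2 <= a] = (2 * Num.sqrt a)%:E.
Proof.
move=> a0.
rewrite (_ : [set y | _] = `[- Num.sqrt a, Num.sqrt a]%classic); last first.
  by apply/seteqP; split => y /=; rewrite sqr_ler_sqrt a0 /= in_itv.
rewrite lebesgue_measure_itv /= lte_fin.
case: ifPn => [_|]; first by rewrite -EFinB; congr (_%:E); ring.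
rewrite -leNgt => h; congr (_%:E).
by have := sqrtr_ge0 a; lra.
Qed.

Lemma area_segment (r d : R) : 0 <= r -> - r <= d <= r ->
  area [set p | d <= p.1 /\ p.1 ^+ 2 + p.2 ^+ 2 <= r ^+ 2] =
  (segment_area r d)%:E.
Proof.
move=> r0 /andP[rd dr].
(* Pushing the chord outwards shrinks the segment at the rate of the chord length, so this is a
   primitive of the chord length, zero at [r]. *)
pose F x : R := - segment_area r x.
rewrite (_ : segment_area r d = F r - F d); last first.
  rewrite /F /segment_area subrr sqrtr0 mulr0.
  have [->|rn0] := eqVneq r 0; first by rewrite expr0n /= !mul0r; ring.
  rewrite divff // [acosc 1]acosc_acos ?acos1; last by apply/andP; split; lra.
  by ring.
have rx (x : R) : d <= x <= r -> 0 <= r ^+ 2 - x ^+ 2 by nra.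
apply: (@area_FTC R true false _ (fun x => 2 * Num.sqrt (r ^+ 2 - x ^+ 2)) F).
- by meas.
- by [].
- by move=> x _; cont.
- by move=> x _; rewrite /F /segment_area; cont.
- move=> x /andP[dx xr]; rewrite /F /segment_area.
  have r0' : 0 < r by lra.
  have h0 : 0 < r ^+ 2 - x ^+ 2 by nra.
  deriv => //.
    by rewrite ltr_pdivrMr // ltr_pdivlMr //; apply/andP; split; lra.
  rewrite (_ : 1 - (x / r) ^+ 2 = (r ^+ 2 - x ^+ 2) / r ^+ 2); last first.
    by field; rewrite gt_eqF.
  rewrite sqrtrM ?ltW // sqrtrV ?sqr_ge0 // sqrtr_sqr gtr0_norm //.
  set s := Num.sqrt _.
  have s0 : 0 < s by rewrite sqrtr_gt0.
  have sE : s ^+ 2 = r ^+ 2 - x ^+ 2 by rewrite sqr_sqrtr // ltW.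
  (* [field] cannot use [sE], so the difference of the two sides is first exhibited as a multiple of
     [r^2 - x^2 - s^2]. *)
  rewrite /GRing.scale /=; apply/eqP; rewrite -subr_eq0; apply/eqP.
  transitivity ((r ^+ 2 - x ^+ 2 - s ^+ 2) / s); last by rewrite sE subrr mul0r.
  by field; rewrite !gt_eqF.
- move=> x; rewrite in_itv /= => xdr; rewrite -mu_sqr_le; last exact: rx.
  congr (mu _); apply/seteqP; split => y /=; first by lra.
  by case/andP : xdr => ? ?; lra.
- move=> x; rewrite in_itv /= => xdr; apply/seteqP; split => y //= [dx xyr].
  by move/negP : xdr; apply; apply/andP; split => //; nra.
Qed.

End segment.

(** * Planar sectors and trigonometry *)

Section sector.
Variable R : realType.
Local Notation mu := (@lebesgue_measure R).

(* Half the dihedral angle of the regular tetrahedron. *)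
Definition half_dihedral : R := acos (Num.sqrt (2 / 3)).

(** The half-angle of the wedge has tangent [1 / sqrt 2], hence cosine [sqrt (2 / 3)]. The vertical
    line at [h], through the two corners of the sector, cuts it into a triangle and a circular
    segment. *)
Lemma area_sector (r : R) : 0 <= r ->
  area [set p | (0 <= p.1 /\ 2 * p.2 ^+ 2 <= p.1 ^+ 2) /\
                p.1 ^+ 2 + p.2 ^+ 2 <= r ^+ 2] =
  (r ^+ 2 * half_dihedral)%:E.
Proof.
move=> r0; rewrite /half_dihedral; set c : R := Num.sqrt (2 / 3).
have c0 : 0 <= c by exact: sqrtr_ge0.
have c2 : c ^+ 2 = 2 / 3 by rewrite sqr_sqrtr //; lra.
have c1 : c <= 1 by nra.
pose h := r * c.
have h0 : 0 <= h by exact: mulr_ge0.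
have hr : h <= r by rewrite /h; nra.
have h2 : h ^+ 2 = 2 / 3 * r ^+ 2 by rewrite exprMn c2; ring.
set s : R := Num.sqrt 2.
have s0 : 0 < s by rewrite sqrtr_gt0; lra.
have s2 : s ^+ 2 = 2 by rewrite sqr_sqrtr //; lra.
rewrite (_ : [set p | _] =
    [set p | (p.1 < h /\ 0 <= p.1) /\ 2 * p.2 ^+ 2 <= p.1 ^+ 2] `|`
    [set p | h <= p.1 /\ p.1 ^+ 2 + p.2 ^+ 2 <= r ^+ 2]); last first.
  apply/seteqP; split => -[x y] /=.
    move=> [[x0 yx] xyr]; have [xh|hx] := ltP x h; [left|right] => //.
  case=> [[[xh x0] yx]|[hx xyr]].
    by split => //; suff : x ^+ 2 < h ^+ 2; [lra|nra].
  have : h ^+ 2 <= x ^+ 2 by nra.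
  by move=> hx2; split => //; split; lra.
have mA : measurable
    [set p : R * R | (p.1 < h /\ 0 <= p.1) /\ 2 * p.2 ^+ 2 <= p.1 ^+ 2].
  by meas.
have mB : measurable [set p : R * R | h <= p.1 /\
    p.1 ^+ 2 + p.2 ^+ 2 <= r ^+ 2] by meas.
rewrite measureU //; last first.
  by apply/seteqP; split => -[x y] //= [[[xh _] _] [hx _]]; lra.
rewrite [X in (_ + X)%E](_ : _ = (segment_area r h)%:E); last first.
  by apply: area_segment => //; apply/andP; split; lra.
rewrite [X in (X + _)%E](_ : _ = (s / 2 * h ^+ 2 - s / 2 * 0 ^+ 2)%:E).
  rewrite -EFinD; congr (_%:E); rewrite /segment_area h2.
  rewrite (_ : r ^+ 2 - 2 / 3 * r ^+ 2 = (r * c * s^-1) ^+ 2); last first.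
    by rewrite !exprMn exprVn c2 s2; field.
  rewrite sqrtr_sqr ger0_norm; last by rewrite !mulr_ge0 ?invr_ge0 // ltW.
  have -> : r ^+ 2 * acosc (h / r) = r ^+ 2 * acos c.
    have [->|rn0] := eqVneq r 0; first by rewrite expr0n !mul0r.
    have -> : h / r = c by rewrite /h; field.
    by rewrite acosc_acos //; apply/andP; split; lra.
  have -> : h * (r * c / s) = 2 / 3 * r ^+ 2 / s.
    by rewrite -h2 /h; field; rewrite gt_eqF.
  have -> : s^-1 = s / 2 by rewrite -s2; field; rewrite gt_eqF.
  by ring.
apply: (@area_FTC R true true _ (fun x => s * x) (fun x => s / 2 * x ^+ 2)
  0 h).
- exact: mA.
- exact: h0.
- by move=> x _; cont.
- by move=> x _; cont.
- by move=> x _; deriv => /=; field.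
- move=> x; rewrite in_itv /= => /andP[x0 xh].
  transitivity ((2 * Num.sqrt (x ^+ 2 / 2))%:E); last first.
    congr (_%:E); rewrite sqrtrM ?sqr_ge0 // sqrtr_sqr ger0_norm //.
    rewrite sqrtrV ?ler0n // -/s (_ : s * x = x * s); last by ring.
    rewrite -[X in X * (_ / _)]s2; field.
    by rewrite gt_eqF.
  rewrite -mu_sqr_le; last by rewrite divr_ge0 ?sqr_ge0.
  congr (mu _); apply/seteqP; split => y /=; first by lra.
  by move=> h1; split => //; lra.
- move=> x; rewrite in_itv /= => xh; apply/seteqP; split => y //= [[x1 x2] _].
  by move: xh; rewrite x1 x2.
Qed.

End sector.

Section trigonometry.
Variable R : realType.
Local Notation half := (@half_dihedral R).

Lemma cos_gt0_lt_pihalf (u : R) : 0 <= u <= pi -> 0 < cos u -> u < pi / 2.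
Proof.
move=> u0 cu; have p0 := pi_gt0 R.
rewrite -ltr_cos ?cos_pihalf // in_itv //=; apply/andP; split; lra.
Qed.

(** The triple-angle formula gives [cos (3 * u) = -1], and [0 <= 3 * u < 3 * pi / 2] leaves only
    [3 * u = pi]. *)
Lemma acos_half : acos (2^-1 : R) = pi / 3.
Proof.
set u := acos _.
have hi : -1 <= (2^-1 : R) <= 1 by apply/andP; split; lra.
have cu : cos u = 2^-1 by rewrite acosK // in_itv.
have u0 : 0 <= u by exact: acos_ge0.
have u2 : u < pi / 2.
  by apply: cos_gt0_lt_pihalf; [rewrite u0 acos_lepi|rewrite cu].
have c3 : cos (3 * u) = -1.
  rewrite (_ : 3 * u = u *+ 2 + u); last by rewrite -mulr_natl; ring.
  rewrite cosD cos_mulr2n sin_mulr2n.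
  have su : sin u ^+ 2 = 3 / 4 by rewrite sin2cos2 cu; field.
  transitivity (2 * cos u ^+ 3 - cos u - 2 * cos u * sin u ^+ 2); first by ring.
  by rewrite su cu; field.
have [h|h] := leP (3 * u) pi.
  have := @cosK R (3 * u); rewrite in_itv /= c3 acosN1 => h'.
  suff : pi = 3 * u by lra.
  by apply: h'; apply/andP; split; lra.
have e : cos (3 * u - pi) = 1 by rewrite cosB cospi sinpi c3; ring.
have := @cosK R (3 * u - pi); rewrite in_itv /= e acos1 => h'.
suff : 0 = 3 * u - pi by lra.
by apply: h'; apply/andP; split; lra.
Qed.

Lemma cos_half_dihedral : cos half = Num.sqrt (2 / 3).
Proof.
rewrite acosK // in_itv /=; apply/andP; split.
  by rewrite (le_trans _ (sqrtr_ge0 _)) //; lra.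
by rewrite -[leRHS]sqrtr1 ler_sqrt //; lra.
Qed.

Lemma cos_dihedral : cos (2 * half) = 1 / 3.
Proof.
rewrite mulr_natl cos_mulr2n cos_half_dihedral sqr_sqrtr; last by lra.
by rewrite -mulr_natl; lra.
Qed.

Lemma half_dihedral_bounds : 0 < half < pi / 4.
Proof.
have c1 : Num.sqrt (2 / 3) < 1 :> R by rewrite -[ltRHS]sqrtr1 ltr_sqrt //; lra.
have c0 : 0 < Num.sqrt (2 / 3) :> R by rewrite sqrtr_gt0; lra.
have h0 : 0 < half by apply: acos_gt0; apply/andP; split; lra.
have h1 : half < pi / 2.
  apply: cos_gt0_lt_pihalf; last by rewrite cos_half_dihedral.
  by rewrite ltW //= acos_lepi //; apply/andP; split; lra.
rewrite h0 /=; suff : 2 * half < pi / 2 by lra.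
apply: cos_gt0_lt_pihalf; first by apply/andP; split; lra.
by rewrite cos_dihedral.
Qed.

Lemma acos_dihedral : acos (1 / 3) = 2 * half.
Proof.
have /andP[h0 h1] := half_dihedral_bounds.
rewrite -cos_dihedral cosK // in_itv /=; apply/andP.
by have := pi_gt0 R; split; lra.
Qed.

(** The complement of the dihedral angle has tangent [(1 / 3) / (2 * sqrt 2 / 3)]. This arctangent
    appears at the lower end of [capwedge_primitive]. *)
Lemma atan_dihedral : atan ((2 * Num.sqrt 2)^-1) = pi / 2 - 2 * half.
Proof.
have /andP[h0 h1] := half_dihedral_bounds.
have p0 := pi_gt0 R.
have s0 : 0 < Num.sqrt 2 :> R by rewrite sqrtr_gt0; lra.
have ss : Num.sqrt 2 ^+ 2 = 2 :> R by rewrite sqr_sqrtr //; lra.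
rewrite -[RHS]tanK; last by rewrite in_itv /=; apply/andP; split; lra.
congr (atan _); rewrite /tan sinB cosB sin_pihalf cos_pihalf cos_dihedral.
rewrite !mul0r mul1r subr0 add0r.
have -> : sin (2 * half) = 2 * Num.sqrt 2 / 3.
  have sin0 : 0 <= sin (2 * half).
    by apply: sin_ge0_pi; apply/andP; split; lra.
  apply/eqP; rewrite -(@eqrXn2 R 2 _ _ isT sin0); last by
    rewrite divr_ge0 // mulr_ge0.
  rewrite sin2cos2 cos_dihedral; apply/eqP.
  have -> : (2 * Num.sqrt 2 / 3) ^+ 2 = 4 / 9 * Num.sqrt 2 ^+ 2 :> R by field.
  by rewrite ss; field.
by field; rewrite gt_eqF.
Qed.

End trigonometry.

(** * Volumes in coordinates *)

Section coordinate_volumes.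
Variable R : realType.
Local Notation mu := (@lebesgue_measure R).
Local Notation half := (@half_dihedral R).
Local Notation s2 := (Num.sqrt 2 : R).
Local Notation s3 := (Num.sqrt 3 : R).

Let s2_gt0 : 0 < s2. Proof. by rewrite sqrtr_gt0; lra. Qed.
Let s2E : s2 ^+ 2 = 2. Proof. by rewrite sqr_sqrtr //; lra. Qed.
Let s3_gt0 : 0 < s3. Proof. by rewrite sqrtr_gt0; lra. Qed.
Let s3E : s3 ^+ 2 = 3. Proof. by rewrite sqr_sqrtr //; lra. Qed.

Lemma area_disk (r : R) : 0 <= r ->
  area [set p | p.1 ^+ 2 + p.2 ^+ 2 <= r ^+ 2] = (pi * r ^+ 2)%:E.
Proof.
move=> r0.
rewrite (_ : [set p | _] =
    [set p | - r <= p.1 /\ p.1 ^+ 2 + p.2 ^+ 2 <= r ^+ 2]); last first.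
  apply/seteqP; split => -[x y] /= h; last by case: h.
  by split => //; nra.
rewrite area_segment //; last by apply/andP; split; lra.
congr (_%:E); rewrite /segment_area sqrrN subrr sqrtr0 mulr0 subr0.
have [->|rn0] := eqVneq r 0; first by rewrite expr0n /= mul0r mulr0.
rewrite mulNr divff // acosc_acos ?acosN1; first by ring.
by apply/andP; split; lra.
Qed.

(** The center is [canP], a vertex of the tetrahedron in canonical position. *)
Lemma volume_ball : volume [set p : R * R * R |
  p.1.1 ^+ 2 + p.1.2 ^+ 2 + (p.2 - 1 / 2) ^+ 2 <= 1] = (4 / 3 * pi)%:E.
Proof.
pose F z : R := pi * (z - (z - 1 / 2) ^+ 3 / 3).
rewrite (_ : 4 / 3 * pi = F (3 / 2) - F (- (1 / 2))); last by rewrite /F; field.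
apply: (@volume_FTC R true false _ (fun z => pi * (1 - (z - 1 / 2) ^+ 2)) F).
- by meas.
- by lra.
- by move=> x _; cont.
- by move=> x _; rewrite /F; cont.
- by move=> x _; rewrite /F; deriv => /=; field.
- move=> z; rewrite in_itv /= => /andP[z0 z1].
  have h : 0 <= 1 - (z - 1 / 2) ^+ 2 by nra.
  have rE := sqr_sqrtr h; set r := Num.sqrt _ in rE.
  transitivity ((pi * r ^+ 2)%:E); last by rewrite rE.
  have r0 : 0 <= r by exact: sqrtr_ge0.
  rewrite -[RHS](area_disk r0).
  by congr (area _); apply/seteqP; split => p /=; lra.
- move=> z; rewrite in_itv /= => hz; apply/seteqP; split => -[x y] //= h.
  by move/negP : hz; apply; apply/andP; split; nra.
Qed.

Lemma volume_lune : volume [set p : R * R * R |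
  (0 <= p.1.1 /\ 2 * p.1.2 ^+ 2 <= p.1.1 ^+ 2) /\
  p.1.1 ^+ 2 + p.1.2 ^+ 2 + (p.2 - 1 / 2) ^+ 2 <= 1] = (4 / 3 * half)%:E.
Proof.
pose F z : R := half * (z - (z - 1 / 2) ^+ 3 / 3).
rewrite (_ : 4 / 3 * half = F (3 / 2) - F (- (1 / 2))); last by rewrite /F;
  field.
apply: (@volume_FTC R true false _ (fun z => half * (1 - (z - 1 / 2) ^+ 2)) F).
- by meas.
- by lra.
- by move=> x _; cont.
- by move=> x _; rewrite /F; cont.
- by move=> x _; rewrite /F; deriv => /=; field.
- move=> z; rewrite in_itv /= => /andP[z0 z1].
  have h : 0 <= 1 - (z - 1 / 2) ^+ 2 by nra.
  have rE := sqr_sqrtr h; set r := Num.sqrt _ in rE.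
  transitivity ((r ^+ 2 * half)%:E); last by rewrite rE mulrC.
  have r0 : 0 <= r by exact: sqrtr_ge0.
  rewrite -[RHS](area_sector r0).
  by congr (area _); apply/seteqP; split => p /= [? ?]; split => //; lra.
- move=> z; rewrite in_itv /= => hz; apply/seteqP; split => -[x y] //= [_ h].
  by move/negP : hz; apply; apply/andP; split; nra.
Qed.

(** The slice at height [z] is a sector of radius [sqrt (1 - z^2) - sqrt 3 / 2]: the rotated unit
    arc has its center at distance [sqrt 3 / 2] on the other side of the axis, and its chord runs
    from [-1/2] to [1/2]. *)
Lemma volume_lemon : volume [set p : R * R * R |
  (0 <= p.1.1 /\ 2 * p.1.2 ^+ 2 <= p.1.1 ^+ 2) /\
  (Num.sqrt (p.1.1 ^+ 2 + p.1.2 ^+ 2) + s3 / 2) ^+ 2 + p.2 ^+ 2 <= 1]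
  = (half * (11 / 12 - s3 * pi / 6))%:E.
Proof.
(* The cross term [- s3 * sqrt (1 - z^2)] of the squared radius is integrated by [s3 / 2] times the
   segment area of the unit disk. *)
pose F z : R := half *
  (z - z ^+ 3 / 3 + 3 / 4 * z +
    s3 / 2 * (1 ^+ 2 * acosc (z / 1) - z * Num.sqrt (1 ^+ 2 - z ^+ 2))).
have h34 : Num.sqrt (3 / 4) = s3 / 2.
  rewrite sqrtrM ?sqrtrV ?ler0n // (_ : 4 = 2 ^+ 2 :> R); last by ring.
  by rewrite sqrtr_sqr ger0_norm.
rewrite (_ : half * _ = F (1 / 2) - F (- (1 / 2))); last first.
  rewrite /F !divr1 !acosc_acos ?acosN; try by apply/andP; split; lra.
  rewrite mul1r acos_half sqrrN.
  rewrite (_ : 1 ^+ 2 - 2^-1 ^+ 2 = 3 / 4); last by field.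
  rewrite h34.
  transitivity (half * (5 / 3 - s3 * pi / 6 - s3 ^+ 2 / 4)); last by field.
  by rewrite s3E; field.
apply: (@volume_FTC R true false _
  (fun z => half * (Num.sqrt (1 - z ^+ 2) - s3 / 2) ^+ 2) F).
- by meas.
- by lra.
- by move=> x _; cont.
- by move=> x _; rewrite /F; cont.
- move=> x /andP[x0 x1]; rewrite /F.
  have h : 0 < 1 - x ^+ 2 by clear -x0 x1; nra.
  deriv => /=; rewrite ?expr1n //; first by apply/andP; split; lra.
  rewrite divr1; set s := Num.sqrt (1 - x ^+ 2).
  have s0 : 0 < s by rewrite sqrtr_gt0.
  have sE : s ^+ 2 = 1 - x ^+ 2 by rewrite sqr_sqrtr // ltW.
  apply/eqP; rewrite -subr_eq0; apply/eqP.
  transitivity (half * ((1 - x ^+ 2 - s ^+ 2) * (1 - s3 / 2 / s) + (3 - s3 ^+ 2)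
    / 4)).
    by field; rewrite gt_eqF.
  by rewrite sE s3E !subrr !mul0r addr0 mulr0.
- move=> z; rewrite in_itv /= => /andP[z0 z1].
  have z2 : 3 / 4 <= 1 - z ^+ 2 by nra.
  set r := Num.sqrt (1 - z ^+ 2) - s3 / 2.
  have r0 : 0 <= r by rewrite subr_ge0 -h34 ler_wsqrtr.
  transitivity ((r ^+ 2 * half)%:E); last by rewrite mulrC.
  rewrite -[RHS](area_sector r0).
  congr (area _); apply/seteqP; split => -[x y] /= [xy h]; split => //.
    rewrite -(@sqr_sqrtr _ (x ^+ 2 + y ^+ 2)) ?addr_ge0 ?sqr_ge0 //.
    rewrite ler_sqr ?nnegrE ?sqrtr_ge0 // lerBrDr.
    rewrite -[leLHS]ger0_norm ?addr_ge0 ?sqrtr_ge0 ?divr_ge0 // -sqrtr_sqr.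
    by rewrite ler_sqrt; lra.
  have : Num.sqrt (x ^+ 2 + y ^+ 2) <= r.
    by rewrite -[leRHS]ger0_norm // -sqrtr_sqr ler_wsqrtr.
  rewrite lerBrDr => h'.
  rewrite -lerBrDr -[leRHS]sqr_sqrtr; last by lra.
  by rewrite ler_sqr ?nnegrE ?addr_ge0 ?sqrtr_ge0 ?divr_ge0.
- move=> z; rewrite in_itv /= => hz; apply/seteqP; split => -[x y] //= [_ h].
  have : (s3 / 2) ^+ 2 <= (Num.sqrt (x ^+ 2 + y ^+ 2) + s3 / 2) ^+ 2.
    by rewrite ler_sqr ?nnegrE ?addr_ge0 ?sqrtr_ge0 ?divr_ge0 // lerDr
      sqrtr_ge0.
  rewrite exprMn s3E exprVn => h'.
  by move/negP : hz; apply; apply/andP; split; nra.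
Qed.

End coordinate_volumes.

(** * The tetrahedron and half of a sharp edge region *)

Section capwedge.
Variable R : realType.
Local Notation mu := (@lebesgue_measure R).
Local Notation half := (@half_dihedral R).
Local Notation s2 := (Num.sqrt 2 : R).

Let s2_gt0 : 0 < s2. Proof. by rewrite sqrtr_gt0; lra. Qed.
Let s2E : s2 ^+ 2 = 2. Proof. by rewrite sqr_sqrtr //; lra. Qed.

(** Slices orthogonal to the common perpendicular of two opposite edges are rectangles with sides
    [s2 * x] and [1 - s2 * x]. The bound [s2 * p.2 <= 1] discards points past the far edge, where
    the squared condition holds again. *)
Lemma volume_tetrahedron_x : volume [set p : R * R * R |
  (0 <= p.2 /\ 2 * p.1.1 ^+ 2 <= p.2 ^+ 2) /\
  (s2 * p.2 <= 1 /\ p.1.2 ^+ 2 <= (1 / 2 - p.2 / s2) ^+ 2)] = (s2 / 12)%:E.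
Proof.
pose F x : R := s2 * x ^+ 2 / 2 - 2 * x ^+ 3 / 3.
have vE : s2^-1 = s2 / 2 by rewrite -[X in _ / X]s2E; field; rewrite gt_eqF.
rewrite (_ : s2 / 12 = F (1 / s2) - F 0); last first.
  rewrite /F div1r vE; transitivity (s2 * s2 ^+ 2 / 24); first by rewrite s2E;
    field.
  transitivity (s2 * s2 ^+ 2 / 8 - s2 * s2 ^+ 2 / 12); first by field.
  by field.
apply: (@volume_FTC R true false _ (fun x => s2 * x * (1 - s2 * x)) F).
- by meas.
- by rewrite divr_ge0 // ltW.
- by move=> x _; cont.
- by move=> x _; rewrite /F; cont.
- move=> x _; rewrite /F; deriv => /=.
  transitivity (s2 * x - s2 ^+ 2 * x ^+ 2); last by ring.
  by rewrite s2E; field.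
- move=> x; rewrite in_itv /= => /andP[x0 x1].
  have hx : s2 * x <= 1 by move: x1; rewrite ler_pdivlMr // mulrC.
  have b0 : 0 <= 1 / 2 - x / s2 by rewrite vE; nra.
  rewrite (_ : [set p | _] =
    [set y | y ^+ 2 <= x ^+ 2 / 2] `*` [set z | z ^+ 2 <= (1 / 2 - x / s2) ^+
      2]).
    have m1 (c : R) : measurable [set y : measurableTypeR R | y ^+ 2 <= c].
      apply: (@measurable_ler_set _ _ _ (fun y : measurableTypeR R => y ^+ 2)).
        exact: exprn_measurable.
      exact: measurable_cst.
    rewrite [LHS](product_measure1E mu mu) //.
    rewrite [X in (X * _)%E]mu_sqr_le ?divr_ge0 ?sqr_ge0 //.
    rewrite [X in (_ * X)%E]mu_sqr_le ?sqr_ge0 //.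
    rewrite -EFinM; congr (_%:E).
    rewrite sqrtrM ?sqr_ge0 // !sqrtr_sqr ger0_norm // ger0_norm //.
    rewrite sqrtrV ?ler0n // vE; transitivity (s2 * x - s2 ^+ 2 * x ^+ 2);
      first by field.
    by ring.
  apply/seteqP; split => -[y z] /=; first by move=> [[_ h] [_ h']]; split => //;
    lra.
  by move=> [h h']; split; split => //; lra.
- move=> x; rewrite in_itv /= => hx; apply/seteqP; split => -[y z] //=.
  move=> [[x0 _] [x1 _]]; move/negP : hx; apply; rewrite x0 /=.
  by rewrite ler_pdivlMr // mulrC.
Qed.

Lemma deriv_capwedge_angle (t : R) : 0 < t -> 3 * t ^+ 2 < 1 ->
  has_deriv t (fun t => acosc (s2 * t / Num.sqrt (1 - t ^+ 2)))
   (- s2 / (Num.sqrt (1 - 3 * t ^+ 2) * (1 - t ^+ 2))).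
Proof.
move=> t0 t1.
have h1 : 0 < 1 - t ^+ 2 by nra.
have h3 : 0 < 1 - 3 * t ^+ 2 by lra.
have n0 : 0 < Num.sqrt (1 - t ^+ 2) by rewrite sqrtr_gt0.
have m0 : 0 < Num.sqrt (1 - 3 * t ^+ 2) by rewrite sqrtr_gt0.
have nE := sqr_sqrtr (ltW h1).
have mE := sqr_sqrtr (ltW h3).
have q0 : 0 < s2 * t by exact: mulr_gt0.
have q1 : s2 * t < Num.sqrt (1 - t ^+ 2).
  rewrite -ltr_sqr ?nnegrE ?ltW // nE exprMn s2E; lra.
have : is_derive t 1 (fun t => acosc (s2 * t / Num.sqrt (1 - t ^+ 2)))
   (- s2 / (Num.sqrt (1 - 3 * t ^+ 2) * (1 - t ^+ 2))).
  deriv => //=.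
  - apply/andP; split; first by rewrite (lt_trans _ (divr_gt0 q0 n0)) //; lra.
    by rewrite ltr_pdivrMr // mul1r.
  - by rewrite gt_eqF.
  rewrite (_ : 1 - (s2 * t / Num.sqrt (1 - t ^+ 2)) ^+ 2 =
      (1 - 3 * t ^+ 2) / (1 - t ^+ 2)); last first.
    rewrite expr_div_n nE exprMn s2E; field; rewrite gt_eqF //; lra.
  rewrite sqrtrM ?ltW // sqrtrV ?ltW //.
  rewrite -[1 - t ^+ 2 in RHS]nE.
  set n := Num.sqrt (1 - t ^+ 2) in n0 nE q1 *.
  set m := Num.sqrt (1 - 3 * t ^+ 2) in m0 mE *.
  apply/eqP; rewrite -subr_eq0; apply/eqP.
  transitivity (- s2 / (m * n ^+ 2) * (n ^+ 2 + t ^+ 2 - 1)).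
    by field; rewrite !gt_eqF.
  by rewrite nE subrK subrr mulr0.
by [].
Qed.

Lemma deriv_capwedge_root (t : R) : 3 * t ^+ 2 < 1 ->
  has_deriv t (fun t => Num.sqrt (1 - 3 * t ^+ 2))
   (- 3 * t / Num.sqrt (1 - 3 * t ^+ 2)).
Proof.
move=> t1; have h3 : 0 < 1 - 3 * t ^+ 2 by lra.
have m0 : 0 < Num.sqrt (1 - 3 * t ^+ 2) by rewrite sqrtr_gt0.
have : is_derive t 1 (fun t => Num.sqrt (1 - 3 * t ^+ 2))
   (- 3 * t / Num.sqrt (1 - 3 * t ^+ 2)).
  by deriv => //=; field; rewrite gt_eqF.
by [].
Qed.

(** Primitive of the segment area with radius [sqrt (1 - t^2)] and chord at [s2 * t]. Integrating
    the [acosc] term by parts and substituting [m = sqrt (1 - 3 * t^2)] leaves [- s2 / 9] times the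
    integral of [(8 + m^2) / (2 + m^2)], whence the linear and arctangent terms; the triangle gives
    the cubic one. *)
Definition capwedge_primitive (t : R) : R :=
  (t - t ^+ 3 / 3) * acosc (s2 * t / Num.sqrt (1 - t ^+ 2))
  - s2 / 9 * Num.sqrt (1 - 3 * t ^+ 2)
  - 2 / 3 * atan (Num.sqrt (1 - 3 * t ^+ 2) / s2)
  + s2 / 9 * (Num.sqrt (1 - 3 * t ^+ 2)) ^+ 3.

Lemma is_derive_capwedge_primitive (t : R) : 0 < t -> 3 * t ^+ 2 < 1 ->
  is_derive t 1 capwedge_primitive
    ((1 - t ^+ 2) * acosc (s2 * t / Num.sqrt (1 - t ^+ 2))
     - s2 * t * Num.sqrt (1 - 3 * t ^+ 2)).
Proof.
move=> t0 t1; have da := deriv_capwedge_angle t0 t1.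
have dm := deriv_capwedge_root t1.
have dp := has_derivD (has_derivI t) (has_derivN (has_derivM (has_derivX 3
  (has_derivI t))
  (has_derivC t (3^-1 : R)))).
have d1 := has_derivN (has_derivM (has_derivC t (s2 / 9)) dm).
have d2 := has_derivN (has_derivM (has_derivC t (2 / 3)) (has_deriv_atan
  (has_derivM dm (has_derivC t s2^-1)))).
have d3 := has_derivM (has_derivC t (s2 / 9)) (has_derivX 3 dm).
apply: (is_derive_has_deriv (has_derivD (has_derivD (has_derivD (has_derivM dp
  da) d1) d2) d3)).
have h1 : 0 < 1 - t ^+ 2 by nra.
have h3 : 0 < 1 - 3 * t ^+ 2 by lra.
have m0 : 0 < Num.sqrt (1 - 3 * t ^+ 2) by rewrite sqrtr_gt0.
have mE := sqr_sqrtr (ltW h3).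
rewrite /= expr_div_n s2E.
set m := Num.sqrt (1 - 3 * t ^+ 2) in m0 mE *.
set u := acosc _.
rewrite (_ : 1 + m ^+ 2 / 2 = 3 / 2 * (1 - t ^+ 2)); last by rewrite mE; field.
have vE : s2^-1 = s2 / 2 by rewrite -[X in _ / X]s2E; field; rewrite gt_eqF.
rewrite vE.
by field; rewrite ?gt_eqF.
Qed.

Lemma capwedge_primitive_root : capwedge_primitive (Num.sqrt (1 / 3)) = 0.
Proof.
have k2 : Num.sqrt (1 / 3) ^+ 2 = 1 / 3 :> R by rewrite sqr_sqrtr //; lra.
have k0 : 0 < Num.sqrt (1 / 3) :> R by rewrite sqrtr_gt0; lra.
rewrite /capwedge_primitive k2.
rewrite (_ : 1 - 3 * (1 / 3) = 0 :> R); last by field.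
rewrite sqrtr0 mul0r atan0 expr0n /= !mulr0 !subr0 addr0.
rewrite (_ : 1 - 1 / 3 = 2 * (1 / 3) :> R); last by field.
rewrite (@sqrtrM _ 2 (1 / 3)) ?ler0n // divff; last by
  rewrite gt_eqF // mulr_gt0.
by rewrite acosc_acos ?acos1 ?mulr0 //; apply/andP; split; lra.
Qed.

(** Here the root is [1 / 2] and the angle is [half]; the coefficient [43 / 24] collects [11 / 24]
    from the [acosc] term and [4 / 3] from the arctangent. *)
Lemma capwedge_primitive_half : capwedge_primitive (1 / 2) =
  43 / 24 * half - s2 / 24 - pi / 3.
Proof.
rewrite /capwedge_primitive.
rewrite (_ : 1 - 3 * (1 / 2) ^+ 2 = (1 / 2) ^+ 2 :> R); last by field.
rewrite sqrtr_sqr ger0_norm; last by lra.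
rewrite (_ : 1 / 2 / s2 = (2 * s2)^-1); last by field; rewrite gt_eqF.
rewrite atan_dihedral.
rewrite (_ : s2 * (1 / 2) / _ = Num.sqrt (2 / 3)).
  rewrite acosc_acos -/(half_dihedral R); first by field.
  have h0 : 0 <= Num.sqrt (2 / 3) :> R by exact: sqrtr_ge0.
  have h1 : Num.sqrt (2 / 3) <= 1 :> R by rewrite -[leRHS]sqrtr1 ler_sqrt; lra.
  by apply/andP; split; lra.
have hx : 0 <= s2 * (1 / 2) / Num.sqrt (1 - (1 / 2) ^+ 2).
  by rewrite divr_ge0 ?sqrtr_ge0 // mulr_ge0 ?sqrtr_ge0 //; lra.
apply/eqP; rewrite -(@eqrXn2 R 2 _ _ isT hx (sqrtr_ge0 _)).
rewrite expr_div_n exprMn s2E !sqr_sqrtr; [|lra|lra].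
by apply/eqP; field.
Qed.

Lemma volume_capwedge ba (A : set (R * R * R)) : measurable A ->
  (forall p, A p <-> p.2 \in Interval (BSide ba (1 / 2)) +oo%O /\
    s2 * p.2 <= p.1.1 /\ p.1.1 ^+ 2 + p.1.2 ^+ 2 + p.2 ^+ 2 <= 1) ->
  volume A = (pi / 3 + s2 / 24 - 43 / 24 * half)%:E.
Proof.
move=> mA AE.
(* The chord at [s2 * t] leaves the disk of radius [sqrt (1 - t^2)] when [3 * t^2 = 1]. *)
pose k : R := Num.sqrt (1 / 3).
have k2 : k ^+ 2 = 1 / 3 by rewrite sqr_sqrtr //; lra.
have k0 : 0 < k by rewrite sqrtr_gt0; lra.
have k12 : 1 / 2 < k by rewrite -ltr_sqr ?nnegrE ?k2; lra.
rewrite (_ : _ - _ = capwedge_primitive k - capwedge_primitive (1 / 2));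
  last first.
  by rewrite capwedge_primitive_root capwedge_primitive_half; ring.
have tk (t : R) : 1 / 2 <= t <= k -> 3 * t ^+ 2 <= 1.
  by move=> /andP[? ?]; suff : t ^+ 2 <= k ^+ 2; [rewrite k2; lra|nra].
have n0 (t : R) : 1 / 2 <= t <= k -> 0 < Num.sqrt (1 - t ^+ 2).
  by move=> /tk h; rewrite sqrtr_gt0; nra.
apply: (@volume_FTC R ba false _ (fun t =>
  (1 - t ^+ 2) * acosc (s2 * t / Num.sqrt (1 - t ^+ 2))
     - s2 * t * Num.sqrt (1 - 3 * t ^+ 2))).
- exact: mA.
- exact: ltW.
- by move=> t ht; cont; rewrite gt_eqF // n0.
- by move=> t ht; rewrite /capwedge_primitive; cont; rewrite gt_eqF // n0.
- move=> t /andP[t1 t2]; apply: is_derive_capwedge_primitive; first by lra.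
  by suff : t ^+ 2 < k ^+ 2; [rewrite k2; lra|nra].
- move=> t ht.
  have /andP[t0 t1] : 1 / 2 <= t <= k.
    by move: ht; rewrite in_itv /= => /andP[/lteifW -> ->].
  have h3 := tk t (introT andP (conj t0 t1)).
  have h1 : 0 <= 1 - t ^+ 2 by nra.
  set r := Num.sqrt (1 - t ^+ 2).
  have r0 : 0 <= r by exact: sqrtr_ge0.
  have rE : r ^+ 2 = 1 - t ^+ 2 by rewrite sqr_sqrtr.
  transitivity ((segment_area r (s2 * t))%:E); last first.
    congr (_%:E); rewrite /segment_area rE exprMn s2E.
    by congr (_ - _ * Num.sqrt _); ring.
  have q0 : 0 <= s2 * t by rewrite mulr_ge0 ?sqrtr_ge0 //; lra.
  have qr : s2 * t <= r.
    by rewrite -ler_sqr ?nnegrE // exprMn s2E rE; lra.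
  have hq : - r <= s2 * t <= r by apply/andP; split => //; lra.
  rewrite -(area_segment r0 hq).
  congr (area _); apply/seteqP; split => -[x y] /=.
    by move=> /AE /= [_ [h h']]; split => //; rewrite rE; lra.
  rewrite rE => -[h h']; apply/AE => /=; split; last by split => //; lra.
  by move: ht; rewrite !in_itv /= andbT => /andP[].
- move=> t ht; apply/seteqP; split => -[x y] //= /AE /= [h [hx h']].
  move/negP : ht; apply; move: h; rewrite !in_itv /= andbT => h.
  rewrite h /= -ler_sqr ?nnegrE; [|by move/lteifW : h; lra|exact: ltW].
  rewrite k2; have : (s2 * t) ^+ 2 <= x ^+ 2.
    have t0 : 0 <= s2 * t by rewrite mulr_ge0 ?ltW //; move/lteifW : h; lra.
    by nra.
  by rewrite exprMn s2E; nra.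
Qed.

End capwedge.

(** * Rigid motions *)

Section rigid.
Variable R : realType.
Local Notation mu := (@lebesgue_measure R).
Local Notation TR := (measurableTypeR R).
Local Notation E3 := (R * R * R)%type.

Definition sqd (p q : E3) : R :=
  (p.1.1 - q.1.1) ^+ 2 + (p.1.2 - q.1.2) ^+ 2 + (p.2 - q.2) ^+ 2.

Definition volume_preserving (f : E3 -> E3) : Prop := measurable_fun setT f /\
  forall A, measurable A -> volume (f @^-1` A) = volume A.

Lemma measurable_slice (A : set E3) z :
  measurable A -> measurable [set p | A (p, z)].
Proof.
move=> mA; have := measurable_ysection z mA.
by congr measurable; apply/seteqP; split => p /=; rewrite /ysection /= inE.
Qed.

Lemma measurable_slice_col (A : set E3) p :
  measurable A -> measurable [set z | A (p, z)].
Proof.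
move=> mA; have := measurable_xsection p mA.
by congr measurable; apply/seteqP; split => z /=; rewrite /xsection /= inE.
Qed.

Lemma measurable_preimage (f : E3 -> E3) A : measurable_fun setT f ->
  measurable A -> measurable (f @^-1` A).
Proof. by move=> mf mA; rewrite -[X in measurable X]setTI; exact: mf. Qed.

Lemma volume_preserving_comp f g : volume_preserving f -> volume_preserving g ->
  volume_preserving (f \o g).
Proof.
move=> [mf vf] [mg vg]; split; first exact: measurableT_comp.
by move=> A mA; rewrite comp_preimage vg ?vf //; exact: measurable_preimage.
Qed.

(** Every vertical column is merely translated. *)
Lemma volume_preserving_shear (g : R * R -> R) : measurable_fun setT g ->
  volume_preserving (fun p => (p.1, p.2 + g p.1)).
Proof.
move=> mg.
have mf : measurable_fun setT (fun p : E3 => (p.1, p.2 + g p.1)).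
  apply/measurable_fun_pair => /=; first exact: measurable_fst.
  apply: measurable_funD; first exact: measurable_snd.
  exact: (measurableT_comp mg measurable_fst).
split=> [|A mA]; first exact: mf.
rewrite (volume_slice_col mA) (volume_slice_col (measurable_preimage mf mA)).
apply: eq_integral => p _ /=.
rewrite -(mu_translate (g p) (measurable_slice_col p mA)).
by congr (mu _).
Qed.

Lemma area_swap (B : set (R * R)) : measurable B ->
  area [set p | B (p.2, p.1)] = area B.
Proof.
move=> mB.
have mf : measurable_fun setT (fun p : R * R => (p.2, p.1)).
  by apply/measurable_fun_pair => /=; [exact: measurable_snd|exact:
    measurable_fst].
have mB' : measurable [set p | B (p.2, p.1)].
  by rewrite -[X in measurable X]setTI; exact: mf.
by rewrite (area_slice mB') (area_slice2 mB).
Qed.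

Definition swap12 (p : E3) : E3 := ((p.1.2, p.1.1), p.2).
Definition swap23 (p : E3) : E3 := ((p.1.1, p.2), p.1.2).

Lemma volume_preserving_swap12 : volume_preserving swap12.
Proof.
have mf : measurable_fun setT swap12.
  apply/measurable_fun_pair => /=; last exact: measurable_snd.
  by apply/measurable_fun_pair => /=; meas_fun.
split=> [|A mA]; first exact: mf.
rewrite (volume_slice mA) (volume_slice (measurable_preimage mf mA)).
apply: eq_integral => z _ /=.
by rewrite -(area_swap (measurable_slice z mA)).
Qed.

(** Compared with [volume_slice_zx], the last two variables trade places in the iterated integral,
    which is what [swap23] needs. *)
Lemma volume_slice_yx (A : set E3) : measurable A ->
  volume A = (\int[mu]_y \int[mu]_x mu [set z | A ((x, y), z)])%E.
Proof.
move=> mA; rewrite (volume_slice_col mA).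
rewrite [LHS](@fubini_tonelli2 _ _ TR TR R mu mu (fun p => mu [set z | A (p,
  z)])) //.
have := measurable_fun_xsection mu mA.
congr (measurable_fun _ _); apply/funext => p; rewrite /=; congr (mu _).
by apply/seteqP; split => z /=; rewrite /xsection /= inE.
Qed.

Lemma volume_slice_zx (A : set E3) : measurable A ->
  volume A = (\int[mu]_z \int[mu]_x mu [set y | A ((x, y), z)])%E.
Proof.
move=> mA; rewrite (volume_slice mA); apply: eq_integral => z _.
by rewrite (area_slice (measurable_slice z mA)).
Qed.

Lemma volume_preserving_swap23 : volume_preserving swap23.
Proof.
have mf : measurable_fun setT swap23.
  apply/measurable_fun_pair => /=; last by meas_fun.
  by apply/measurable_fun_pair => /=; meas_fun.
split=> [|A mA]; first exact: mf.
by rewrite (volume_slice_zx mA) (volume_slice_yx (measurable_preimage mf mA)).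
Qed.

Lemma eq_volume_preserving f g : f =1 g -> volume_preserving f ->
  volume_preserving g.
Proof. by move=> /funext ->. Qed.

Definition rot12 (c s : R) (p : E3) : E3 :=
  ((c * p.1.1 - s * p.1.2, s * p.1.1 + c * p.1.2), p.2).

Let shear12 (k : R) (p : E3) : E3 := ((p.1.1 + k * p.1.2, p.1.2), p.2).

Let volume_preserving_shear12 k : volume_preserving (shear12 k).
Proof.
have mg : measurable_fun setT (fun p : R * R => k * p.1) by meas_fun.
have hs := volume_preserving_shear mg.
have h := volume_preserving_comp volume_preserving_swap23
  (volume_preserving_comp hs volume_preserving_swap23).
have := volume_preserving_comp volume_preserving_swap12
  (volume_preserving_comp h volume_preserving_swap12).
by apply: eq_volume_preserving => -[[x y] z].
Qed.

(* A rotation by an angle other than pi is a product of three shears. *)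
Lemma volume_preserving_rot12 c s : c ^+ 2 + s ^+ 2 = 1 ->
  volume_preserving (rot12 c s).
Proof.
have main c' s' : s' != 0 -> c' ^+ 2 + s' ^+ 2 = 1 ->
    volume_preserving (rot12 c' s').
  (* For a rotation by [theta] this is [- tan (theta / 2)], the coefficient of the two outer shears;
     the middle one has coefficient [s']. *)
  move=> s0 cs; pose k := (c' - 1) / s'.
  have hy := volume_preserving_comp volume_preserving_swap12
    (volume_preserving_comp (volume_preserving_shear12 s')
      volume_preserving_swap12).
  have := volume_preserving_comp (volume_preserving_shear12 k)
    (volume_preserving_comp hy (volume_preserving_shear12 k)).
  apply: eq_volume_preserving => -[[x y] z]; rewrite /rot12 /swap12 /shear12 /=.
  have ks : k * s' = c' - 1 by rewrite /k; field.
  have kc : k * (1 + c') = - s'.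
    rewrite /k; apply: (mulIf s0); rewrite mulrAC mulfVK //.
    by transitivity (c' ^+ 2 - 1); [ring|rewrite -cs; ring].
  congr (_, _, _).
    transitivity ((1 + k * s') * x + (k * (1 + c') + (k * (k * s' - (c' - 1))))
      * y); first by ring.
    by rewrite kc ks subrr; ring.
  by transitivity (s' * x + (1 + k * s') * y); [ring|rewrite ks; ring].
move=> cs; have [s0|] := eqVneq s 0; last by move=> /main; exact.
have : (c == 1) || (c == -1).
  by rewrite -eqf_sqr expr1n -cs s0 expr0n addr0.
move=> /orP[] /eqP ->; rewrite s0.
  have : volume_preserving id by split => //.
  by apply: eq_volume_preserving => -[[x y] z]; rewrite /rot12 /=;
    congr (_, _, _); ring.
(* The half-turn, which has no such factorization, is the square of the quarter-turn. *)
have h01 : volume_preserving (rot12 0 1).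
  by apply: main; [exact: oner_neq0|ring].
have := volume_preserving_comp h01 h01.
by apply: eq_volume_preserving => -[[x y] z]; rewrite /rot12 /=;
    congr (_, _, _); ring.
Qed.

(** Surjectivity serves to pull back the points of an arc in [smoothing]. *)
Definition rigid (f : E3 -> E3) : Prop :=
  [/\ volume_preserving f, forall p q, sqd (f p) (f q) = sqd p q
    & forall q, exists p, f p = q].

Lemma rigid_comp f g : rigid f -> rigid g -> rigid (f \o g).
Proof.
move=> [vf df sf] [vg dg sg]; split; first exact: volume_preserving_comp.
  by move=> p q; rewrite /= df dg.
by move=> q; have [p <-] := sf q; have [r <-] := sg p; exists r.
Qed.

Lemma rigid_swap12 : rigid swap12.
Proof.
split; first exact: volume_preserving_swap12.
  by move=> p q; rewrite /sqd /=; ring.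
by move=> [[x y] z]; exists ((y, x), z).
Qed.

Lemma rigid_swap23 : rigid swap23.
Proof.
split; first exact: volume_preserving_swap23.
  by move=> p q; rewrite /sqd /=; ring.
by move=> [[x y] z]; exists ((x, z), y).
Qed.

Lemma rigid_rot12 c s : c ^+ 2 + s ^+ 2 = 1 -> rigid (rot12 c s).
Proof.
move=> cs; split; first exact: volume_preserving_rot12.
  move=> [[x y] z] [[x' y'] z']; rewrite /sqd /rot12 /=.
  transitivity ((c ^+ 2 + s ^+ 2) * ((x - x') ^+ 2 + (y - y') ^+ 2) +
    (z - z') ^+ 2); first by ring.
  by rewrite cs mul1r.
move=> [[x y] z]; exists ((c * x + s * y, c * y - s * x), z).
rewrite /rot12 /=; congr (_, _, _).
  by rewrite -[RHS]mul1r -cs; ring.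
by rewrite -[RHS]mul1r -cs; ring.
Qed.

Let rigid_shift3 (w : R) : rigid (fun p => (p.1, p.2 + w)).
Proof.
split; first exact: (volume_preserving_shear (g := fun=> w)).
  by move=> p q; rewrite /sqd /=; ring.
by move=> [p z]; exists (p, z - w); rewrite /= subrK.
Qed.

Lemma rigid_shift (v : E3) : rigid (fun p => p + v).
Proof.
have s23 := rigid_comp rigid_swap23 (rigid_comp (rigid_shift3 v.1.2)
  rigid_swap23).
have s1 := rigid_comp rigid_swap23 (rigid_comp (rigid_shift3 v.1.1)
  rigid_swap23).
have s12 := rigid_comp rigid_swap12 (rigid_comp s1 rigid_swap12).
have := rigid_comp s12 (rigid_comp s23 (rigid_shift3 v.2)).
by congr rigid; apply/funext => -[[x y] z]; case: v {s23 s1 s12} =>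
  [[v1 v2] v3].
Qed.

Definition neg2 (p : E3) : E3 := ((p.1.1, - p.1.2), p.2).

(** This reflection is a quarter-turn followed by a transposition of coordinates. *)
Lemma rigid_neg2 : rigid neg2.
Proof.
have h : rigid (rot12 0 1) by apply: rigid_rot12; ring.
have := rigid_comp rigid_swap12 h.
congr rigid; apply/funext => -[[x y] z]; rewrite /swap12 /rot12 /neg2 /=.
by congr (_, _, _); ring.
Qed.

End rigid.

(** * Canonical position of a regular tetrahedron *)

Section canonical.
Variable R : realType.
Local Notation E3 := (R * R * R)%type.
Local Notation s2 := (Num.sqrt 2 : R).

Let s2_gt0 : 0 < s2. Proof. by rewrite sqrtr_gt0; lra. Qed.
Let s2E : s2 ^+ 2 = 2. Proof. by rewrite sqr_sqrtr //; lra. Qed.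

Definition regular_tetrahedron (p q r s : E3) : Prop :=
  (sqd p q = 1 /\ sqd p r = 1 /\ sqd p s = 1) /\
  (sqd q r = 1 /\ sqd q s = 1 /\ sqd r s = 1).

(** The edge [p q] is centered on the third axis and the opposite edge is parallel to the second, at
    the distance [sqrt 2 / 2] between opposite edges. Both coordinate planes through the first axis
    are then symmetry planes of the tetrahedron. *)
Definition canP : E3 := ((0, 0), 1 / 2).
Definition canQ : E3 := ((0, 0), - (1 / 2)).
Definition canR : E3 := ((s2 / 2, 1 / 2), 0).
Definition canS : E3 := ((s2 / 2, - (1 / 2)), 0).

Definition to_canonical (p q r s : E3) : Prop :=
  exists f, rigid f /\ (f p = canP /\ f q = canQ) /\ (f r = canR /\ f s = canS).

Lemma givens (x y : R) : exists c s, c ^+ 2 + s ^+ 2 = 1 /\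
  c * x - s * y = Num.sqrt (x ^+ 2 + y ^+ 2) /\ s * x + c * y = 0.
Proof.
set rho := Num.sqrt _.
have rE : rho ^+ 2 = x ^+ 2 + y ^+ 2 by rewrite sqr_sqrtr // addr_ge0 ?sqr_ge0.
have [r0|r0] := eqVneq rho 0.
  have : x ^+ 2 + y ^+ 2 = 0 by rewrite -rE r0 expr0n.
  move/eqP; rewrite paddr_eq0 ?sqr_ge0 // !sqrf_eq0 => /andP[/eqP -> /eqP ->].
  by exists 1, 0; rewrite r0; split; [|split]; ring.
exists (x / rho), (- y / rho); split; [|split].
- transitivity ((x ^+ 2 + y ^+ 2) / rho ^+ 2); first by field.
  by rewrite -rE divff // expf_neq0.
- transitivity ((x ^+ 2 + y ^+ 2) / rho); first by field.
  by rewrite -rE; field.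
- by field.
Qed.

Lemma rigid_tetrahedron f p q r s : rigid f -> regular_tetrahedron p q r s ->
  regular_tetrahedron (f p) (f q) (f r) (f s).
Proof. by case=> _ df _; rewrite /regular_tetrahedron !df. Qed.

Lemma to_canonical_rigid f p q r s : rigid f ->
  to_canonical (f p) (f q) (f r) (f s) -> to_canonical p q r s.
Proof.
by move=> rf [g [rg h]]; exists (g \o f); split => //; exact: rigid_comp.
Qed.

Lemma to_canonical_axis r s : regular_tetrahedron canP canQ r s ->
  to_canonical canP canQ r s.
Proof.
case: r s => [[r1 r2] r3] [[t1 t2] t3]; rewrite /regular_tetrahedron /sqd /=.
move=> [[_ [pr ps]] [qr [qs rs]]].
have r30 : r3 = 0 by lra.
have t30 : t3 = 0 by lra.
subst r3 t3.
have {}pr : r1 ^+ 2 + r2 ^+ 2 = 3 / 4 by lra.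
have {}ps : t1 ^+ 2 + t2 ^+ 2 = 3 / 4 by lra.
have {qr qs} rs : r1 * t1 + r2 * t2 = 1 / 4 by lra.
(* Rotating about the third axis brings the midpoint of [r s] onto the first axis; the distances
   then determine everything but the sign of [b]. *)
have [c [s [cs [h1 h2]]]] := givens (r1 + t1) (r2 + t2).
have hE : (r1 + t1) ^+ 2 + (r2 + t2) ^+ 2 = 2 by lra.
rewrite hE in h1.
pose a := c * r1 - s * r2; pose b := s * r1 + c * r2.
have ta : c * t1 - s * t2 = s2 - a by rewrite /a -h1; ring.
have tb : s * t1 + c * t2 = - b.
  by rewrite /b; apply/eqP; rewrite -subr_eq0 opprK; apply/eqP; rewrite -h2;
    ring.
have ab : a ^+ 2 + b ^+ 2 = 3 / 4.
  by rewrite -pr -[RHS]mul1r -cs /a /b; ring.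
have ab' : (s2 - a) ^+ 2 + b ^+ 2 = 3 / 4.
  by rewrite -ta -(sqrrN b) -tb -ps -[RHS]mul1r -cs; ring.
have s2a : s2 * a = 1.
  suff : 2 * (s2 * a) = s2 ^+ 2 by rewrite s2E; lra.
  transitivity (s2 ^+ 2 + (a ^+ 2 + b ^+ 2) - ((s2 - a) ^+ 2 + b ^+ 2));
    first by ring.
  by rewrite ab ab' addrK.
have aE : a = s2 / 2.
  transitivity (s2 ^+ 2 * a / 2); first by rewrite s2E; field.
  by transitivity (s2 * (s2 * a) / 2); [field|rewrite s2a; field].
have b2 : b ^+ 2 = (1 / 2) ^+ 2.
  transitivity (a ^+ 2 + b ^+ 2 - s2 ^+ 2 / 4); first by rewrite {1}aE; field.
  by rewrite ab s2E; field.
have rf := rigid_rot12 cs.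
apply: (to_canonical_rigid rf).
have rP : rot12 c s canP = canP by rewrite /rot12 /=; congr (_, _, _); ring.
have rQ : rot12 c s canQ = canQ by rewrite /rot12 /=; congr (_, _, _); ring.
rewrite rP rQ /rot12 /= -/a -/b ta tb.
have sa : s2 - a = s2 / 2 by rewrite aE; field.
rewrite sa aE.
(* The sign of [b] is the orientation of the tetrahedron, corrected by a reflection when
   negative. *)
move/eqP : b2; rewrite eqf_sqr => /orP[/eqP ->|/eqP ->].
  exists id; split; last by [].
  by split => // q; exists q.
exists (@neg2 R); split; first exact: rigid_neg2.
by rewrite /neg2 /canP /canQ /canR /canS /= !oppr0 !opprK.
Qed.

Theorem regular_tetrahedron_canonical p q r s : regular_tetrahedron p q r s ->
  to_canonical p q r s.
Proof.
move=> tet.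
(* This translation moves the midpoint of [p q] to the origin. Two Givens rotations then align half
   of [p - q] with the first axis, and the swaps turn that axis into the third. *)
pose v : E3 := ((- (p.1.1 + q.1.1) / 2, - (p.1.2 + q.1.2) / 2),
  - (p.2 + q.2) / 2).
have rv := rigid_shift v.
have [c [t [ct [h1 h2]]]] := givens ((p.1.1 - q.1.1) / 2) ((p.1.2 - q.1.2) / 2).
set rho := Num.sqrt _ in h1.
have rhoE : rho ^+ 2 =
    ((p.1.1 - q.1.1) / 2) ^+ 2 + ((p.1.2 - q.1.2) / 2) ^+ 2.
  by rewrite sqr_sqrtr // addr_ge0 ?sqr_ge0.
have [c' [t' [ct' [h1' h2']]]] := givens rho ((p.2 - q.2) / 2).
have hE : rho ^+ 2 + ((p.2 - q.2) / 2) ^+ 2 = (1 / 2) ^+ 2.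
  rewrite rhoE; move: tet => [[pq _] _].
  by transitivity (sqd p q / 4); [rewrite /sqd; field|rewrite pq; field].
rewrite hE sqrtr_sqr ger0_norm in h1'; last by lra.
pose g := @swap23 R \o (@swap12 R \o (rot12 c' t' \o (@swap23 R \o
  (rot12 c t \o (fun p => p + v))))).
have rg : rigid g.
  apply: rigid_comp; first exact: rigid_swap23.
  apply: rigid_comp; first exact: rigid_swap12.
  apply: rigid_comp; first exact: rigid_rot12.
  apply: rigid_comp; first exact: rigid_swap23.
  by apply: rigid_comp; first exact: rigid_rot12.
have gp : g p = canP.
  have e1 : p.1.1 + v.1.1 = (p.1.1 - q.1.1) / 2 by rewrite /v /=; field.
  have e2 : p.1.2 + v.1.2 = (p.1.2 - q.1.2) / 2 by rewrite /v /=; field.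
  have e3 : p.2 + v.2 = (p.2 - q.2) / 2 by rewrite /v /=; field.
  by rewrite /g /swap23 /swap12 /rot12 /= e1 e2 e3 h1 h2 h1' h2'.
have gq : g q = canQ.
  have e1 : q.1.1 + v.1.1 = - ((p.1.1 - q.1.1) / 2) by rewrite /v /=; field.
  have e2 : q.1.2 + v.1.2 = - ((p.1.2 - q.1.2) / 2) by rewrite /v /=; field.
  have e3 : q.2 + v.2 = - ((p.2 - q.2) / 2) by rewrite /v /=; field.
  rewrite /g /swap23 /swap12 /rot12 /= e1 e2 e3 !mulrN -!opprD h1 h2.
  by rewrite !mulrN -!opprD h1' h2' !oppr0.
apply: (to_canonical_rigid rg); have := rigid_tetrahedron rg tet.
by rewrite gp gq; exact: to_canonical_axis.
Qed.

End canonical.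

(** * Regions cut out by a regular tetrahedron *)

Section regions.
Variable R : realType.
Local Notation mu := (@lebesgue_measure R).
Local Notation E3 := (R * R * R)%type.
Local Notation s2 := (Num.sqrt 2 : R).
Local Notation s3 := (Num.sqrt 3 : R).
Local Notation half := (@half_dihedral R).

Let s2_gt0 : 0 < s2. Proof. by rewrite sqrtr_gt0; lra. Qed.
Let s2E : s2 ^+ 2 = 2. Proof. by rewrite sqr_sqrtr //; lra. Qed.

(** Barycentric coordinate of [x] at [p], from distances alone: summing [1 - b_i - e2] over the
    vertices gives [3 - 4 * e2], so the four squared distances determine [e2] and then each
    [b_i]. *)
Definition bary (p q r s x : E3) : R :=
  1 / 4 + (sqd x p + sqd x q + sqd x r + sqd x s) / 4 - sqd x p.

(* When [sqd p q = 1], [axial] is the signed distance to the mid-plane of [p] and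
   [q], [radial] the squared distance to their axis, and [lemon p q x <= 1] cuts
   out the solid obtained by rotating a unit arc about its chord [p q]. *)
Definition axial (p q x : E3) : R := (sqd x q - sqd x p) / 2.
Definition radial (p q x : E3) : R :=
  (sqd x p + sqd x q) / 2 - 1 / 4 - axial p q x ^+ 2.
Definition lemon (p q x : E3) : R :=
  (Num.sqrt (radial p q x) + s3 / 2) ^+ 2 + axial p q x ^+ 2.

Local Notation cP := (canP R).
Local Notation cQ := (canQ R).
Local Notation cR := (canR R).
Local Notation cS := (canS R).

Lemma can_bary (x : E3) :
  [/\ bary cP cQ cR cS x = 1 / 2 - s2 / 2 * x.1.1 + x.2,
      bary cQ cP cR cS x = 1 / 2 - s2 / 2 * x.1.1 - x.2,
      bary cR cP cQ cS x = s2 / 2 * x.1.1 + x.1.2 &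
      bary cS cP cQ cR x = s2 / 2 * x.1.1 - x.1.2].
Proof.
rewrite /bary /sqd /=; set X := x.1.1; set Y := x.1.2; set Z := x.2.
have e : (X - s2 / 2) ^+ 2 = X ^+ 2 - s2 * X + 1 / 2.
  by transitivity (X ^+ 2 - s2 * X + s2 ^+ 2 / 4); [field|rewrite s2E; field].
by rewrite e; split; field.
Qed.

Lemma can_axial (x : E3) : axial cP cQ x = x.2.
Proof. by rewrite /axial /sqd /=; field. Qed.

Lemma can_radial (x : E3) : radial cP cQ x = x.1.1 ^+ 2 + x.1.2 ^+ 2.
Proof. by rewrite /radial can_axial /sqd /=; field. Qed.

Lemma measurable_sqd (p : E3) : measurable_fun setT (fun x => sqd x p).
Proof. by rewrite /sqd; meas_fun. Qed.

Lemma measurable_bary (p q r s : E3) : measurable_fun setT (bary p q r s).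
Proof. by rewrite /bary /sqd; meas_fun. Qed.

Lemma measurable_lemon (p q : E3) : measurable_fun setT (lemon p q).
Proof. by rewrite /lemon /radial /axial /sqd; meas_fun. Qed.

Lemma volume_rigid (f : E3 -> E3) (A B : set E3) : rigid f -> measurable B ->
  (forall x, A x <-> B (f x)) -> volume A = volume B.
Proof.
move=> [[mf vf] _ _] mB AB; rewrite -(vf _ mB); congr volume.
by apply/seteqP; split => x /AB.
Qed.

Lemma rigid_neg1 : rigid (fun p : E3 => ((- p.1.1, p.1.2), p.2)).
Proof.
exact: (rigid_comp (@rigid_swap12 R) (rigid_comp (@rigid_neg2 R) (@rigid_swap12
  R))).
Qed.

Lemma rigid_neg3 : rigid (fun p : E3 => (p.1, - p.2)).
Proof.
have := rigid_comp (@rigid_swap23 R) (rigid_comp (@rigid_neg2 R) (@rigid_swap23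
  R)).
by congr rigid; apply/funext => -[[x y] z].
Qed.

Lemma bary_rigid f p q r s x : rigid f ->
  bary (f p) (f q) (f r) (f s) (f x) = bary p q r s x.
Proof. by move=> [_ df _]; rewrite /bary !df. Qed.

Lemma lemon_rigid f p q x : rigid f -> lemon (f p) (f q) (f x) = lemon p q x.
Proof. by move=> [_ df _]; rewrite /lemon /radial /axial !df. Qed.

Lemma sqd_rigid f (p q : E3) : rigid f -> sqd (f p) (f q) = sqd p q.
Proof. by move=> [_ df _]. Qed.

Lemma volume_unit_ball p q r s : regular_tetrahedron p q r s ->
  volume [set x : E3 | sqd x p <= 1] = (4 / 3 * pi)%:E.
Proof.
move=> /regular_tetrahedron_canonical [f [rf [[fp fq] [fr fs]]]].
rewrite -volume_ball; apply: (volume_rigid rf); first by meas.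
move=> x; rewrite /mkset -(sqd_rigid x p rf) fp /sqd /=.
by rewrite !subr0.
Qed.

Lemma volume_dihedral p q r s : regular_tetrahedron p q r s ->
  volume [set x : E3 | (0 <= bary r p q s x /\ 0 <= bary s p q r x) /\
    sqd x p <= 1]
  = (4 / 3 * half)%:E.
Proof.
move=> /regular_tetrahedron_canonical [f [rf [[fp fq] [fr fs]]]].
rewrite -volume_lune; apply: (volume_rigid rf); first by meas.
move=> x /=; rewrite -(sqd_rigid x p rf) -!(bary_rigid _ _ _ _ x rf) fp fq fr
  fs.
case: (can_bary (f x)) => _ _ -> ->; rewrite /sqd /= !subr0.
set X := (f x).1.1; set Y := (f x).1.2.
have e : (s2 / 2 * X) ^+ 2 = X ^+ 2 / 2.
  by rewrite exprMn expr_div_n s2E; field.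
split=> -[[h1 h2] h3]; split => //.
  have h0 : 0 <= s2 / 2 * X by lra.
  split; last by nra.
  by rewrite -(pmulr_rge0 _ (x := s2 / 2)) //; lra.
have h0 : 0 <= s2 / 2 * X by rewrite mulr_ge0 //; lra.
by split; nra.
Qed.

Lemma volume_tetrahedron p q r s : regular_tetrahedron p q r s ->
  volume [set x : E3 | (0 <= bary p q r s x /\ 0 <= bary q p r s x) /\
                  (0 <= bary r p q s x /\ 0 <= bary s p q r x)] = (s2 / 12)%:E.
Proof.
move=> /regular_tetrahedron_canonical [f [rf [[fp fq] [fr fs]]]].
rewrite -volume_tetrahedron_x.
apply: (volume_rigid (rigid_comp (@rigid_swap23 R) (rigid_comp (@rigid_swap12 R)
  rf))).
  by meas.
move=> x; rewrite /= /swap23 /swap12 /= -!(bary_rigid _ _ _ _ x rf) fp fq fr fs.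
case: (can_bary (f x)) => -> -> -> ->.
set X := (f x).1.1; set Y := (f x).1.2; set Z := (f x).2.
have vE : s2^-1 = s2 / 2 by rewrite -[X in _ / X]s2E; field; rewrite gt_eqF.
have e : (s2 / 2 * X) ^+ 2 = X ^+ 2 / 2.
  by rewrite exprMn expr_div_n s2E; field.
have -> : X / s2 = s2 / 2 * X by rewrite vE mulrC.
split=> [[[h1 h2] [h3 h4]]|[[h1 h2] [h3 h4]]].
  have h0 : 0 <= s2 / 2 * X by lra.
  split; last by split; [lra|nra].
  by split; [rewrite -(pmulr_rge0 _ (x := s2 / 2)) //; lra|nra].
have h0 : 0 <= s2 / 2 * X by rewrite mulr_ge0 //; lra.
by split; split; nra.
Qed.

Lemma volume_face_plane p q r s : regular_tetrahedron p q r s ->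
  volume [set x : E3 | 0 <= bary r p q s x /\ bary r p q s x <= 0] = 0%E.
Proof.
move=> /regular_tetrahedron_canonical [f [rf [[fp fq] [fr fs]]]].
pose B := [set x : E3 | 0 <= s2 / 2 * x.1.1 + x.1.2 /\
                        s2 / 2 * x.1.1 + x.1.2 <= 0].
have mB : measurable B by rewrite /B; meas.
transitivity (volume B).
  apply: (volume_rigid rf) => // x; rewrite /= -!(bary_rigid _ _ _ _ x rf).
  by rewrite fp fq fr fs; case: (can_bary (f x)) => _ _ -> _.
rewrite (volume_slice_zx mB) integral0_eq // => z _.
rewrite integral0_eq // => x _.
rewrite (_ : [set y | _] = [set - (s2 / 2 * x)]) ?lebesgue_measure_set1 //.
apply/seteqP; split => y; rewrite /B /=; first by move=> [h1 h2]; lra.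
by move=> ->; lra.
Qed.

Lemma volumeU (A B : set E3) : measurable A -> measurable B ->
  A `&` B = set0 -> volume (A `|` B) = (volume A + volume B)%E.
Proof. exact: (@measureU _ _ _ (@area R \x mu)%E). Qed.

Lemma le_volume (A B : set E3) : measurable A -> measurable B ->
  A `<=` B -> (volume A <= volume B)%E.
Proof.
by move=> mA mB; apply: (@le_measure _ _ _ (@area R \x mu)%E); rewrite inE.
Qed.

Lemma volume_ge0 (A : set E3) : (0 <= volume A)%E.
Proof. exact: (@measure_ge0 _ _ _ (@area R \x mu)%E). Qed.

Lemma eq_volume_null (A B N : set E3) : measurable A -> measurable B ->
  measurable N -> volume N = 0%E -> A `<=` B -> B `<=` A `|` N ->
  volume A = volume B.
Proof.
move=> mA mB mN N0 AB BAN.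
rewrite -(setDUK AB) volumeU //; [|exact: measurableD|]; last first.
  by apply/seteqP; split => x // [? []].
rewrite (_ : volume (B `\` A) = 0%E) ?adde0 //.
apply/eqP; rewrite eq_le volume_ge0 andbT -N0; apply: le_volume => //.
  exact: measurableD.
by move=> x [/BAN []].
Qed.

End regions.

Ltac meas_region := lazymatch goal with
  | |- measurable (mkset (fun x => @?A x /\ @?B x)) =>
      apply: (@measurableI _ _ (mkset A) (mkset B)); meas_region
  | |- measurable (mkset (fun x => is_true (@Order.le _ _ (@?f x) (@?g x)))) =>
      apply: (@measurable_ler_set _ _ _ f g); meas_region
  | |- measurable (mkset (fun x => is_true (@Order.lt _ _ (@?f x) (@?g x)))) =>
      apply: (@measurable_ltr_set _ _ _ f g); meas_region
  | |- measurable_fun _ (bary _ _ _ _) => exact: measurable_bary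
  | |- measurable_fun _ (lemon _ _) => exact: measurable_lemon
  | |- measurable_fun _ (fun x => bary _ _ _ _ x) => exact: measurable_bary
  | |- measurable_fun _ (fun x => lemon _ _ x) => exact: measurable_lemon
  | |- measurable_fun _ (fun x => sqd x _) => exact: measurable_sqd
  | |- measurable_fun _ _ => exact: measurable_cst
  end.

(** * Volumes of the edge regions *)

Section edge_regions.
Variable R : realType.
Local Notation mu := (@lebesgue_measure R).
Local Notation E3 := (R * R * R)%type.
Local Notation s2 := (Num.sqrt 2 : R).
Local Notation s3 := (Num.sqrt 3 : R).
Local Notation half := (@half_dihedral R).

Let s2_gt0 : 0 < s2. Proof. by rewrite sqrtr_gt0; lra. Qed.
Let s2E : s2 ^+ 2 = 2. Proof. by rewrite sqr_sqrtr //; lra. Qed.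

Lemma sqdC (p q : E3) : sqd p q = sqd q p.
Proof. by rewrite /sqd; ring. Qed.

Lemma regular_swap12 (p q r s : E3) :
  regular_tetrahedron p q r s -> regular_tetrahedron q p r s.
Proof. by rewrite /regular_tetrahedron (sqdC q p); tauto. Qed.

Lemma regular_swap23 (p q r s : E3) :
  regular_tetrahedron p q r s -> regular_tetrahedron p r q s.
Proof. by rewrite /regular_tetrahedron (sqdC r q); tauto. Qed.

Lemma regular_swap34 (p q r s : E3) :
  regular_tetrahedron p q r s -> regular_tetrahedron p q s r.
Proof. by rewrite /regular_tetrahedron (sqdC s r); tauto. Qed.

Lemma baryC12 (p q r s : E3) : bary p q r s = bary p r q s.
Proof. by apply/funext => x; rewrite /bary; ring. Qed.

Lemma baryC23 (p q r s : E3) : bary p q r s = bary p q s r.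
Proof. by apply/funext => x; rewrite /bary; ring. Qed.

Lemma bary_sum (p q r s x : E3) :
  bary p q r s x + bary q p r s x + bary r p q s x + bary s p q r x = 1.
Proof. by rewrite /bary; field. Qed.

Lemma volumeU0 (N1 N2 : set E3) : measurable N1 -> measurable N2 ->
  volume N1 = 0%E -> volume N2 = 0%E -> volume (N1 `|` N2) = 0%E.
Proof.
move=> m1 m2 v1 v2; rewrite -v1; apply/esym.
apply: (@eq_volume_null _ _ _ N2) => //; exact: measurableU.
Qed.

Lemma volume_ae (A B N : set E3) : measurable A -> measurable B ->
  measurable N -> volume N = 0%E -> (forall x, ~ N x -> A x <-> B x) ->
  volume A = volume B.
Proof.
move=> mA mB mN N0 AB; have mAB : measurable (A `&` B) by exact: measurableI.
transitivity (volume (A `&` B)).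
  apply/esym/(@eq_volume_null _ _ _ N) => // x Ax.
  by have [?|/AB h] := pselect (N x); [right|left; split => //; exact/h].
apply: (@eq_volume_null _ _ _ N) => // x Bx.
by have [?|/AB h] := pselect (N x); [right|left; split => //; exact/h].
Qed.

(** Two inequalities instead of an equation, a form that [meas_region] accepts. *)
Definition face_plane (p q r s : E3) : set E3 :=
  [set x | 0 <= bary p q r s x /\ bary p q r s x <= 0].

Lemma measurable_face_plane p q r s : measurable (face_plane p q r s).
Proof. by rewrite /face_plane; meas_region. Qed.

Definition face_planes (p q r s : E3) : set E3 :=
  face_plane q p r s `|` (face_plane r p q s `|` face_plane s p q r).

Lemma measurable_face_planes p q r s : measurable (face_planes p q r s).
Proof.
by apply: measurableU; [|apply: measurableU]; exact: measurable_face_plane.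
Qed.

Lemma volume_face_planes p q r s : regular_tetrahedron p q r s ->
  volume (face_planes p q r s) = 0%E.
Proof.
move=> t; have mf := measurable_face_plane.
have hr := volume_face_plane t.
have hs := volume_face_plane (regular_swap34 t).
have hq := volume_face_plane (regular_swap23 t).
apply: (volumeU0 (mf _ _ _ _) _ hq (volumeU0 (mf _ _ _ _) (mf _ _ _ _) hr hs)).
by apply: measurableU; exact: mf.
Qed.

Lemma face_planesP p q r s x : ~ face_planes p q r s x ->
  [/\ (0 < bary q p r s x \/ bary q p r s x < 0),
      (0 < bary r p q s x \/ bary r p q s x < 0) &
      (0 < bary s p q r x \/ bary s p q r x < 0)].
Proof.
have aux (c : R) : ~ (0 <= c /\ c <= 0) -> 0 < c \/ c < 0.
  by move=> h; have [|] := ltP 0 c; [left|move=> c0; right; lra].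
move=> h; split; apply: aux => hc; apply: h.
- by left.
- by right; left.
- by right; right.
Qed.

Lemma volume_edge_smoothed p q r s : regular_tetrahedron p q r s ->
  volume [set x : E3 | (bary r p q s x < 0 /\ bary s p q r x < 0) /\
                       lemon p q x <= 1]
  = (half * (11 / 12 - s3 * pi / 6))%:E.
Proof.
move=> t.
transitivity (volume [set x : E3 | (bary r p q s x <= 0 /\
    bary s p q r x <= 0) /\ lemon p q x <= 1]).
  apply: (volume_ae _ _ (measurable_face_planes p q r s)
    (volume_face_planes t)).
  - by meas_region.
  - by meas_region.
  move=> x /face_planesP[_ hr hs] /=; split=> -[[h1 h2] h3]; split => //; split;
    lra.
have [f [rf [[fp fq] [fr fs]]]] := regular_tetrahedron_canonical t.
rewrite -volume_lemon.
(* The points beyond both faces fill the wedge vertically opposite to the dihedral angle; the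
   reflection carries it to the wedge of [volume_lemon]. *)
apply: (volume_rigid (rigid_comp (@rigid_neg1 R) rf)); first by meas.
move=> x /=; rewrite -!(bary_rigid _ _ _ _ x rf) -(lemon_rigid _ _ x rf).
rewrite fp fq fr fs; case: (can_bary (f x)) => _ _ -> ->.
rewrite /lemon can_radial can_axial sqrrN.
set X := (f x).1.1; set Y := (f x).1.2.
have e : (s2 / 2 * X) ^+ 2 = X ^+ 2 / 2.
  by rewrite exprMn expr_div_n s2E; field.
split=> -[[h1 h2] h3]; split => //.
  have h0 : s2 / 2 * X <= 0 by lra.
  split; last by nra.
  by rewrite -(pmulr_rge0 _ (x := s2 / 2)) //; lra.
have h0 : 0 <= s2 / 2 * (- X) by rewrite mulr_ge0 //; lra.
by split; nra.
Qed.

(** On the side of [r] of the mid-plane of [r s], the distance to [s] is the larger one, so only the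
    ball about [s] matters; with [s] as origin this is the solid of [volume_capwedge]. The flag [ba]
    includes or excludes the mid-plane, so that two halves partition the region. *)
Lemma volume_half_edge (ba : bool) p q r s : regular_tetrahedron p q r s ->
  volume [set x : E3 | (bary r p q s x <= 0 /\ bary s p q r x <= 0) /\
    ((if ba then bary s p q r x <= bary r p q s x
      else bary s p q r x < bary r p q s x) /\
     (sqd x r <= 1 /\ sqd x s <= 1))]
  = (pi / 3 + s2 / 24 - 43 / 24 * half)%:E.
Proof.
move=> t; have [f [rf [[fp fq] [fr fs]]]] := regular_tetrahedron_canonical t.
pose v : E3 := ((s2 / 2, 1 / 2), 0).
have rg := rigid_comp (@rigid_swap23 R)
  (rigid_comp (rigid_shift v) (rigid_comp (@rigid_neg1 R) rf)).
pose B := [set y : E3 | (if ba then 1 / 2 <= y.2 else 1 / 2 < y.2) /\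
  (s2 * y.2 <= y.1.1 /\ y.1.1 ^+ 2 + y.1.2 ^+ 2 + y.2 ^+ 2 <= 1)].
have mB : measurable B by rewrite /B; case: (ba); meas.
have BE y : B y <-> y.2 \in Interval (BSide ba (1 / 2)) +oo%O /\
    s2 * y.2 <= y.1.1 /\ y.1.1 ^+ 2 + y.1.2 ^+ 2 + y.2 ^+ 2 <= 1.
  by rewrite in_itv /= andbT /B /=; case: (ba).
rewrite -(volume_capwedge mB BE).
apply: (volume_rigid rg mB) => x; rewrite /B /= /swap23 /=.
rewrite -!(bary_rigid _ _ _ _ x rf) -(sqd_rigid x r rf) -(sqd_rigid x s rf).
rewrite fp fq fr fs; case: (can_bary (f x)) => _ _ -> ->.
rewrite /sqd /= addr0 subr0.
set X := (f x).1.1; set Y := (f x).1.2; set Z := (f x).2.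
have e1 : s2 * (s2 / 2 * X) = X.
  by transitivity (s2 ^+ 2 * X / 2); [field|rewrite s2E; field].
have e2 : s2 * (s2 / 2 * Y) = Y.
  by transitivity (s2 ^+ 2 * Y / 2); [field|rewrite s2E; field].
have wedge : (s2 * (Y + 1 / 2) <= - X + s2 / 2) <-> (s2 / 2 * X + Y <= 0).
  split=> h.
    rewrite -(pmulr_rle0 _ (x := s2)) // mulrDr e1; lra.
  by move: h; rewrite -(pmulr_rle0 _ (x := s2)) // mulrDr e1; lra.
have nrm : (- X + s2 / 2) ^+ 2 = (X - s2 / 2) ^+ 2 by ring.
have sgn : (if ba then s2 / 2 * X - Y <= s2 / 2 * X + Y
    else s2 / 2 * X - Y < s2 / 2 * X + Y) =
    (if ba then 1 / 2 <= Y + 1 / 2 else 1 / 2 < Y + 1 / 2).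
  by clear; case: ba; apply/idP/idP; lra.
rewrite sgn nrm; split=> [[[h1 h2] [h3 [h4 h5]]]|[h3 [/wedge h4 h5]]].
  by split => //; split; [exact/wedge|lra].
have Y0 : 0 <= Y by case: (ba) h3; lra.
by split; [split; lra|split => //; split; nra].
Qed.

Lemma volume_edge_sharp p q r s : regular_tetrahedron p q r s ->
  volume [set x : E3 | (bary r p q s x < 0 /\ bary s p q r x < 0) /\
    (sqd x r <= 1 /\ sqd x s <= 1)]
  = (2 * (pi / 3 + s2 / 24 - 43 / 24 * half))%:E.
Proof.
move=> t.
transitivity (volume [set x : E3 | (bary r p q s x <= 0 /\
    bary s p q r x <= 0) /\ (sqd x r <= 1 /\ sqd x s <= 1)]).
  apply: (volume_ae _ _ (measurable_face_planes p q r s)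
    (volume_face_planes t)).
  - by meas_region.
  - by meas_region.
  move=> x /face_planesP[_ hr hs] /=; split=> -[[h1 h2] h3]; split => //; split;
    lra.
have h1 := volume_half_edge true t.
have h2 := volume_half_edge false (regular_swap34 t).
rewrite mulr_natl mulr2n EFinD -{1}h1 -h2 -volumeU.
- congr volume; apply/seteqP; split => x /=.
    have [h|h] := leP (bary s p q r x) (bary r p q s x).
      by move=> [[? ?] [? ?]]; left.
    by move=> [[? ?] [? ?]]; right.
  by case=> -[[? ?] [? [? ?]]].
- by meas_region.
- by meas_region.
- apply/seteqP; split => x //= [[_ [h3 _]] [_ [h4 _]]].
  by move: h3; rewrite leNgt h4.
Qed.

End edge_regions.

(** * Girard's formula and the cone over a spherical triangle *)

Section girard.
Variable R : realType.
Local Notation E3 := (R * R * R)%type.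
Local Notation half := (@half_dihedral R).

Lemma volume_split (b : E3 -> R) (A : set E3) : measurable_fun setT b ->
  measurable A -> volume A =
  (volume (A `&` [set x | (0 <= b x)%R]) + volume (A `&` [set x | (b x <
    0)%R]))%E.
Proof.
move=> mb mA.
have m1 : measurable [set x | 0 <= b x].
  by apply: measurable_ler_set => //; exact: measurable_cst.
have m2 : measurable [set x | b x < 0].
  by apply: measurable_ltr_set => //; exact: measurable_cst.
rewrite -volumeU; [|exact: measurableI|exact: measurableI|]; last first.
  by apply/seteqP; split => x //= [[_ h] [_ h']]; move: h; rewrite leNgt h'.
congr volume; apply/seteqP; split => x /=; last by case=> -[].
by move=> Ax; have [h|h] := leP 0 (b x); [left|right].
Qed.

Lemma volume_fin (A B : set E3) (c : R) : measurable A -> measurable B ->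
  A `<=` B -> volume B = c%:E -> volume A = (fine (volume A))%:E.
Proof.
move=> mA mB AB vB; rewrite fineK // ge0_fin_numE ?volume_ge0 //.
by rewrite (le_lt_trans (le_volume mA mB AB)) // vB ltry.
Qed.

(* Inclusion-exclusion behind Girard's formula: three lunes cut out of a
   centrally symmetric body by three planes through its center. *)
Lemma girard (D : set E3) (b1 b2 b3 : E3 -> R) (V l : R) :
  measurable D -> measurable_fun setT b1 -> measurable_fun setT b2 ->
  measurable_fun setT b3 -> volume D = V%:E ->
  let P (b : E3 -> R) : set E3 := [set x | 0 <= b x] in
  let N (b : E3 -> R) : set E3 := [set x | b x < 0] in
  volume (D `&` P b1 `&` P b2) = l%:E ->
  volume (D `&` P b1 `&` P b3) = l%:E ->
  volume (D `&` P b2 `&` P b3) = l%:E ->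
  volume (D `&` P b1 `&` P b2 `&` P b3) = volume (D `&` N b1 `&` N b2 `&` N b3)
    ->
  volume (D `&` P b1 `&` P b2 `&` N b3) = volume (D `&` N b1 `&` N b2 `&` P b3)
    ->
  volume (D `&` P b1 `&` N b2 `&` P b3) = volume (D `&` N b1 `&` P b2 `&` N b3)
    ->
  volume (D `&` N b1 `&` P b2 `&` P b3) = volume (D `&` P b1 `&` N b2 `&` N b3)
    ->
  volume (D `&` P b1 `&` P b2 `&` P b3) = ((3 * l - V / 2) / 2)%:E.
Proof.
move=> mD m1 m2 m3 vD P N l12 l13 l23 r1 r2 r3 r4.
have mP b : measurable_fun setT b -> measurable (P b).
  by move=> mb; apply: measurable_ler_set => //; exact: measurable_cst.
have mN b : measurable_fun setT b -> measurable (N b).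
  by move=> mb; apply: measurable_ltr_set => //; exact: measurable_cst.
pose v (A : set E3) := fine (volume A).
(* All pieces lie in [D], which has finite volume, so the relations become real equations fit for
   [lra]. *)
have vE A : measurable A -> A `<=` D -> volume A = (v A)%:E.
  by move=> mA AD; exact: (volume_fin mA mD AD vD).
have mDI A B : measurable A -> A `<=` D -> measurable B ->
    measurable (A `&` B) /\ A `&` B `<=` D.
  by move=> mA AD mB; split; [exact: measurableI|move=> x [/AD]].
have sub A b : measurable A /\ A `<=` D -> measurable_fun setT b ->
   (measurable (A `&` P b) /\ A `&` P b `<=` D) /\
   (measurable (A `&` N b) /\ A `&` N b `<=` D).
  move=> [mA AD] mb.
  by split; [exact: (mDI _ _ mA AD (mP _ mb))|exact: (mDI _ _ mA AD (mN _ mb))].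
have sp A b : measurable A /\ A `<=` D -> measurable_fun setT b ->
    v A = v (A `&` P b) + v (A `&` N b).
  move=> hA mb; have [[mAP APD] [mAN AND]] := sub A b hA mb.
  apply: EFin_inj; rewrite EFinD -(vE _ hA.1 hA.2) -(vE _ mAP APD) -(vE _ mAN
    AND).
  exact: (volume_split mb hA.1).
have hD : measurable D /\ D `<=` D by split.
have [hP hN] := sub _ _ hD m1.
have [hPP hPN] := sub _ _ hP m2.
have [hNP hNN] := sub _ _ hN m2.
have [hPPP hPPN] := sub _ _ hPP m3.
have [hPNP hPNN] := sub _ _ hPN m3.
have [hNPP hNPN] := sub _ _ hNP m3.
have [hNNP hNNN] := sub _ _ hNN m3.
rewrite (vE _ hPPP.1 hPPP.2); congr (_%:E).
have e0 : v D = V by apply: EFin_inj; rewrite -vE.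
have e12 : v (D `&` P b1 `&` P b2) = l by apply: EFin_inj;
  rewrite -l12 (vE _ hPP.1 hPP.2).
have e13 : v (D `&` P b1 `&` P b3) = l.
  exact: (congr1 fine l13).
have e23 : v (D `&` P b2 `&` P b3) = l by exact: (congr1 fine l23).
have q1 : v (D `&` P b1 `&` P b2 `&` P b3) = v (D `&` N b1 `&` N b2 `&` N b3).
  exact: (congr1 fine r1).
have q2 : v (D `&` P b1 `&` P b2 `&` N b3) = v (D `&` N b1 `&` N b2 `&` P b3).
  exact: (congr1 fine r2).
have q3 : v (D `&` P b1 `&` N b2 `&` P b3) = v (D `&` N b1 `&` P b2 `&` N b3).
  exact: (congr1 fine r3).
have q4 : v (D `&` N b1 `&` P b2 `&` P b3) = v (D `&` P b1 `&` N b2 `&` N b3).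
  exact: (congr1 fine r4).
have s0 := sp _ _ hD m1.
have s1 := sp _ _ hP m2.
have s2 := sp _ _ hN m2.
have s3 := sp _ _ hPP m3.
have s4 := sp _ _ hPN m3.
have s5 := sp _ _ hNP m3.
have s6 := sp _ _ hNN m3.
have s7 := sp _ _ (sub _ _ hP m3).1 m2.
have s8 := sp _ _ (sub _ _ (sub _ _ hD m2).1 m3).1 m1.
rewrite (setIAC (D `&` P b1) (P b3)) (setIAC (D `&` P b1) (P b3)) in s7.
rewrite (setIAC _ (P b3) (P b1)) (setIAC D (P b2) (P b1)) in s8.
rewrite (setIAC _ (P b3) (N b1)) (setIAC D (P b2) (N b1)) in s8.
(* Symmetry pairs the eight pieces, so [V / 2 = x0 + x1 + x2 + x4]; since [l] is [x0] plus any one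
   of the other three, [V / 2 = 3 * l - 2 * x0]. *)
move: q1 q2 q3 q4 s0 s1 s2 s3 s4 s5 s6 s7 s8 e0 e12 e13 e23; clear.
move: (v (D `&` P b1 `&` P b2 `&` P b3)) => x0.
move: (v (D `&` P b1 `&` P b2 `&` N b3)) => x1.
move: (v (D `&` P b1 `&` N b2 `&` P b3)) => x2.
move: (v (D `&` P b1 `&` N b2 `&` N b3)) => x3.
move: (v (D `&` N b1 `&` P b2 `&` P b3)) => x4.
move: (v (D `&` N b1 `&` P b2 `&` N b3)) => x5.
move: (v (D `&` N b1 `&` N b2 `&` P b3)) => x6.
move: (v (D `&` N b1 `&` N b2 `&` N b3)) => x7.
move: (v (D `&` P b1 `&` P b2)) => x8.
move: (v (D `&` P b1 `&` N b2)) => x9.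
move: (v (D `&` N b1 `&` P b2)) => x10.
move: (v (D `&` N b1 `&` N b2)) => x11.
move: (v (D `&` P b1 `&` P b3)) => x12.
move: (v (D `&` P b2 `&` P b3)) => x13.
move: (v (D `&` P b1)) => x14.
move: (v (D `&` N b1)) => x15.
move: (v (D)) => x16.
lra.
Qed.

(** One third of the area [6 * half - pi] of a spherical triangle whose three angles are
    [2 * half]. *)
Lemma volume_sector (p q r s : E3) : regular_tetrahedron p q r s ->
  volume ([set x : E3 | sqd x p <= 1] `&` [set x | 0 <= bary q p r s x] `&`
   [set x | 0 <= bary r p q s x] `&` [set x | 0 <= bary s p q r x])
  = (2 * half - pi / 3)%:E.
Proof.
move=> t.
have -> : 2 * half - pi / 3 = (3 * (4 / 3 * half) - 4 / 3 * pi / 2) / 2 by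
  field.
(* Reflection in the point [p]. The coordinates at [q], [r], [s] are affine and vanish at [p], hence
   change sign. *)
pose rho (x : E3) : E3 := ((- x.1.1, - x.1.2), - x.2) + (p + p).
have rrho : rigid rho.
  apply: (rigid_comp (f := fun x => x + (p + p)) (g := fun x : E3 => ((- x.1.1,
    - x.1.2), - x.2))).
    exact: rigid_shift.
  exact: (rigid_comp (@rigid_neg1 R) (rigid_comp (@rigid_neg2 R) (@rigid_neg3
    R))).
have rhop x : sqd (rho x) p = sqd x p by rewrite /sqd /rho /=; ring.
have [[pq [pr ps]] [qr [qs rs]]] := t.
have bp (a b c : E3) x : sqd p a = 1 -> sqd p b = 1 -> sqd p c = 1 ->
    bary a p b c (rho x) = - bary a p b c x.
  move=> ha hb hc.
  have b0 : bary a p b c p = 0.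
    by rewrite /bary ha hb hc (_ : sqd p p = 0); [field|rewrite /sqd; ring].
  transitivity (2 * bary a p b c p - bary a p b c x); last by rewrite b0; ring.
  by rewrite /bary /sqd /rho /=; field.
have mb := @measurable_bary R.
have mD : measurable [set x : E3 | sqd x p <= 1].
  by apply: measurable_ler_set; [exact: measurable_sqd|exact: measurable_cst].
have mP (b : E3 -> R) : measurable_fun setT b -> measurable [set x | 0 <= b x].
  by move=> h; apply: measurable_ler_set => //; exact: measurable_cst.
have mN (b : E3 -> R) : measurable_fun setT b -> measurable [set x | b x < 0].
  by move=> h; apply: measurable_ltr_set => //; exact: measurable_cst.
have mpre (B : set E3) : measurable B -> measurable (rho @^-1` B).
  by move=> mB; apply: measurable_preimage => //; case: rrho => -[].
(* A sign change exchanges strict and weak inequalities, so opposite pieces correspond only off the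
   face planes. *)
have refl (A B : set E3) : measurable A -> measurable B ->
    (forall x, ~ face_planes p q r s x -> A x <-> B (rho x)) ->
    volume A = volume B.
  move=> mA mB AB; transitivity (volume (rho @^-1` B)); last first.
    by case: rrho => -[_ vr] _ _; exact: vr.
  exact: (volume_ae mA (mpre _ mB) (measurable_face_planes p q r s)
    (volume_face_planes t) AB).
have lune q' r' s' : regular_tetrahedron p q' r' s' ->
    volume ([set x : E3 | sqd x p <= 1] `&` [set x | 0 <= bary q' p r' s' x] `&`
   [set x | 0 <= bary r' p q' s' x]) = (4 / 3 * half)%:E.
  move=> /regular_swap34 /regular_swap23 t'; rewrite -(volume_dihedral t').
  rewrite (baryC23 q' p s') (baryC23 r' p s').
  congr volume; apply/seteqP; split => x /=; tauto.
have aux (c : R) : 0 < c \/ c < 0 ->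
    ((- c < 0) = (0 <= c)) * ((0 <= - c) = (c < 0)).
  by move=> h; split; apply/idP/idP; case: h; lra.
have t' := regular_swap34 t.
have mq := mb q p r s; have mr := mb r p q s; have ms := mb s p q r.
apply: (girard mD mq mr ms (volume_unit_ball t) (lune _ _ _ t)).
- by rewrite (baryC23 q p r); exact: lune.
- rewrite (baryC23 r p q) (baryC23 s p q); apply: lune.
  exact: (regular_swap34 (regular_swap23 t)).
- apply: refl; [by do 3 (apply: measurableI; auto)..|].
  move=> x /face_planesP[/aux h1 /aux h2 /aux h3].
  by rewrite /= rhop !bp // !h1 !h2 !h3.
- apply: refl; [by do 3 (apply: measurableI; auto)..|].
  move=> x /face_planesP[/aux h1 /aux h2 /aux h3].
  by rewrite /= rhop !bp // !h1 !h2 !h3.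
- apply: refl; [by do 3 (apply: measurableI; auto)..|].
  move=> x /face_planesP[/aux h1 /aux h2 /aux h3].
  by rewrite /= rhop !bp // !h1 !h2 !h3.
- apply: refl; [by do 3 (apply: measurableI; auto)..|].
  move=> x /face_planesP[/aux h1 /aux h2 /aux h3].
  by rewrite /= rhop !bp // !h1 !h2 !h3.
Qed.

End girard.

(** * Smoothing an edge *)

Section smoothing.
Variable R : realType.
Local Notation E3 := (R * R * R)%type.
Local Notation s2 := (Num.sqrt 2 : R).
Local Notation s3 := (Num.sqrt 3 : R).
Local Notation cP := (canP R).
Local Notation cQ := (canQ R).
Local Notation cR := (canR R).
Local Notation cS := (canS R).

Let s2_gt0 : 0 < s2. Proof. by rewrite sqrtr_gt0; lra. Qed.
Let s2E : s2 ^+ 2 = 2. Proof. by rewrite sqr_sqrtr //; lra. Qed.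
Let s3_gt0 : 0 < s3. Proof. by rewrite sqrtr_gt0; lra. Qed.
Let s3E : s3 ^+ 2 = 3. Proof. by rewrite sqr_sqrtr //; lra. Qed.

Definition e2 (a b c d : R) : R := a * b + a * c + a * d + b * c + b * d + c *
  d.

(** For an affine combination of points, the squared distance to [p] is the sum of
    [b_i * |a_i - p|^2] minus the sum of [b_i * b_j * |a_i - a_j|^2] over pairs; unit edges turn the
    two sums into [1 - b_p] and [e2]. *)
Lemma sqd_bary (p q r s x : E3) : regular_tetrahedron p q r s ->
  sqd x p = 1 - bary p q r s x - e2 (bary p q r s x) (bary q p r s x)
    (bary r p q s x) (bary s p q r x).
Proof.
move=> /regular_tetrahedron_canonical [f [rf [[fp fq] [fr fs]]]].
rewrite -(sqd_rigid x p rf) -!(bary_rigid _ _ _ _ x rf) fp fq fr fs.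
case: (can_bary (f x)) => -> -> -> ->; rewrite /e2 /sqd /=.
set X := (f x).1.1; set Y := (f x).1.2; set Z := (f x).2.
transitivity (1 / 4 - Z + Y ^+ 2 + Z ^+ 2 + s2 ^+ 2 / 2 * X ^+ 2).
  by rewrite s2E; field.
by field.
Qed.

Definition opposite_arc (p q r s : E3) : set E3 :=
  [set y | (sqd y p = 1 /\ sqd y q = 1) /\ (sqd y r <= 1 /\ sqd y s <= 1)].

(* In coordinates along [r] and [s] of the circle carrying the arc, the point of
   the arc that is farthest from a point outside the opposite dihedral angle is
   an endpoint. *)
Lemma arc_endpoint_le (b c al be : R) :
  al ^+ 2 + be ^+ 2 + 2 / 3 * (al * be) = 1 ->
  1 <= 3 * al + be -> 1 <= al + 3 * be -> b <= c -> 0 <= c ->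
  3 * b + c <= b * (3 * al + be) + c * (al + 3 * be).
Proof.
move=> n h1 h2 bc c0.
have u1 : 3 * al + be <= 3 by nra.
have u2 : al + 3 * be <= 3 by nra.
have a0 : 0 <= al by lra.
have b0 : 0 <= be by lra.
have ab : 1 <= al + be by nra.
(* The right side of the goal exceeds the left by this product plus four times the next one. *)
have k1 : (c - b) * (3 - (3 * al + be)) >= 0 by apply: mulr_ge0; lra.
have k2 : c * (al + be - 1) >= 0 by apply: mulr_ge0; lra.
by nra.
Qed.

Lemma ler_oppl_sqr (u v : R) : 0 <= v -> u ^+ 2 <= v ^+ 2 -> - u <= v.
Proof. by move=> v0 uv; nra. Qed.

(** Beyond both faces, the farthest point of the whole circle belongs to the arc, and its squared
    distance is [lemon]. Elsewhere the farthest point of the arc is the endpoint [r] or [s], which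
    the two hypotheses already control. *)
Lemma can_smoothing (x : E3) : sqd x cR <= 1 -> sqd x cS <= 1 ->
  (forall y, opposite_arc cP cQ cR cS y -> sqd x y <= 1) <->
  (bary cR cP cQ cS x < 0 -> bary cS cP cQ cR x < 0 -> lemon cP cQ x <= 1).
Proof.
move=> xR xS; case: (can_bary x) => _ _ -> ->.
rewrite /lemon can_radial can_axial.
move: xR xS; rewrite /sqd /=.
set X := x.1.1; set Y := x.1.2; set Z := x.2 => xR xS.
set rho := Num.sqrt (X ^+ 2 + Y ^+ 2).
have rhoE : rho ^+ 2 = X ^+ 2 + Y ^+ 2 by rewrite sqr_sqrtr // addr_ge0
  ?sqr_ge0.
have rho0 : 0 <= rho by exact: sqrtr_ge0.
pose b := s2 / 2 * X + Y; pose c := s2 / 2 * X - Y.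
have XE : X = s2 / 2 * (b + c).
  by transitivity (s2 ^+ 2 / 2 * X); [rewrite s2E; field|rewrite /b /c; field].
split=> [H bn cn|H].
  have rhop : 0 < rho.
    rewrite lt_def rho0 andbT; apply/eqP => r0.
    have : X ^+ 2 = 0.
      by apply: le_anti; rewrite sqr_ge0 andbT; move: rhoE (sqr_ge0 Y);
        rewrite r0 expr0n /=; lra.
    move/eqP; rewrite sqrf_eq0 => /eqP X0; move: bn cn; rewrite X0; lra.
  (* Scales [(X, Y)] to the circle of radius [sqrt 3 / 2] carrying the arc; the farthest point is
     the antipode of the result. *)
  pose k := s3 / 2 / rho.
  have k0 : 0 < k by rewrite /k !divr_gt0.
  have kr : k * rho = s3 / 2 by rewrite /k; field; rewrite gt_eqF.
  have k2 : k ^+ 2 * (X ^+ 2 + Y ^+ 2) = 3 / 4.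
    by rewrite -rhoE -exprMn kr expr_div_n s3E; field.
  pose al := - (k * b); pose be := - (k * c).
  have a0 : 0 <= al by rewrite /al -mulrN mulr_ge0 ?ltW // /b; lra.
  have c0 : 0 <= be by rewrite /be -mulrN mulr_ge0 ?ltW // /c; lra.
  have nab : al ^+ 2 + be ^+ 2 + 2 / 3 * (al * be) = 1.
    transitivity (k ^+ 2 * (2 * s2 ^+ 2 / 3 * X ^+ 2 + 4 / 3 * Y ^+ 2)).
      by rewrite /al /be /b /c; field.
    rewrite s2E; transitivity (4 / 3 * (k ^+ 2 * (X ^+ 2 + Y ^+ 2))); first by
      field.
    by rewrite k2; field.
  (* Indeed [(al + be)^2 = 1 + 4 / 3 * (al * be)]. The coordinates [al] and [be] of the antipode at
     [r] and [s] are nonnegative, and this bound puts it on the arc. *)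
  have ab1 : 1 <= al + be by nra.
  have e (u v : R) : (u - s2 / 2) ^+ 2 + v = u ^+ 2 - s2 * u + 1 / 2 + v.
    by transitivity (u ^+ 2 - s2 * u + s2 ^+ 2 / 4 + v); [field|rewrite s2E;
      field].
  have sX : s2 * (- (k * X)) = al + be by rewrite /al /be /b /c; field.
  have /H : opposite_arc cP cQ cR cS ((- (k * X), - (k * Y)), 0).
    have yy : (k * X) ^+ 2 + (k * Y) ^+ 2 = 3 / 4 by rewrite -k2; ring.
    have kY : k * Y = (be - al) / 2 by rewrite /al /be /b /c; field.
    rewrite /opposite_arc /sqd /=; split.
      by split; move: yy; rewrite !subr0 !sqrrN => ->; field.
    rewrite -!addrA !e sX; split.
      have : al + be + (- (k * Y)) >= 1 / 2 by rewrite kY; lra.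
      by move: yy; rewrite !sqrrN; lra.
    have : al + be + (k * Y) >= 1 / 2 by rewrite kY; lra.
    by move: yy; rewrite !sqrrN; lra.
  rewrite /=; apply: le_trans; rewrite le_eqVlt; apply/orP; left; apply/eqP.
  transitivity (rho ^+ 2 + 2 * (k * rho) * rho + (k * rho) ^+ 2 + Z ^+ 2).
    by rewrite kr; field.
  rewrite exprMn rhoE (_ : 2 * (k * rho) * rho = 2 * k * rho ^+ 2); last by
    ring.
  by rewrite rhoE; ring.
move=> [[y1 y2] y3]; rewrite /opposite_arc /sqd /= => -[[yP yQ] [yR yS]].
have y30 : y3 = 0 by lra.
subst y3.
have yy : y1 ^+ 2 + y2 ^+ 2 = 3 / 4 by lra.
have e (u v : R) : (u - s2 / 2) ^+ 2 + v = u ^+ 2 - s2 * u + 1 / 2 + v.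
  by transitivity (u ^+ 2 - s2 * u + s2 ^+ 2 / 4 + v); [field|rewrite s2E;
    field].
pose al := s2 / 2 * y1 + y2; pose be := s2 / 2 * y1 - y2.
have y1E : y1 = s2 / 2 * (al + be).
  by transitivity (s2 ^+ 2 / 2 * y1); [rewrite s2E; field|rewrite /al /be;
    field].
have y2E : y2 = (al - be) / 2 by rewrite /al /be; field.
have YE : Y = (b - c) / 2 by rewrite /b /c; field.
have XY1 : X * y1 = (b + c) * (al + be) / 2.
  rewrite XE y1E; transitivity (s2 ^+ 2 / 4 * ((b + c) * (al + be))); first by
    field.
  by rewrite s2E; field.
have sX : s2 * X = b + c.
  by rewrite /b /c; field.
have sy : s2 * y1 = al + be.
  by rewrite /al /be; field.
have nab : al ^+ 2 + be ^+ 2 + 2 / 3 * (al * be) = 1.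
  transitivity (4 / 3 * (s2 ^+ 2 / 2 * y1 ^+ 2 + y2 ^+ 2)).
    by rewrite /al /be; field.
  by rewrite s2E divff // mul1r yy; field.
move: yR yS xR xS; rewrite -!addrA !e sX sy => yR yS xR xS.
have h1 : 1 <= 3 * al + be by clear -yR yy y2E; nra.
have h2 : 1 <= al + 3 * be by clear -yS yy y2E; nra.
have XY : X * y1 + Y * y2 = (b * (3 * al + be) + c * (al + 3 * be)) / 4.
  by rewrite XY1 YE y2E; field.
have dxy : (X - y1) ^+ 2 + ((Y - y2) ^+ 2 + (Z - 0) ^+ 2) =
    X ^+ 2 + Y ^+ 2 + Z ^+ 2 + 3 / 4 - 2 * (X * y1 + Y * y2).
  by rewrite -yy; ring.
rewrite dxy XY.
have [bn|b0] := ltP b 0; last first.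
  have [bc|cb] := leP b c.
    have := arc_endpoint_le nab h1 h2 bc (le_trans b0 bc).
    by move: xR; rewrite YE; lra.
  have nba : be ^+ 2 + al ^+ 2 + 2 / 3 * (be * al) = 1.
    by rewrite -[RHS]nab; ring.
  have h1' : 1 <= 3 * be + al by lra.
  have h2' : 1 <= be + 3 * al by lra.
  have := arc_endpoint_le nba h1' h2' (ltW cb) b0.
  by move: xS; rewrite YE; lra.
have [cn|c0] := ltP c 0; last first.
  have bc : b <= c by lra.
  have := arc_endpoint_le nab h1 h2 bc c0.
  by move: xR; rewrite YE; lra.
have := H bn cn; rewrite -XY.
(* Cauchy-Schwarz bounds the distance to any point of the circle by that to its point opposite to
   [x]. *)
have CS : - (X * y1 + Y * y2) <= rho * (s3 / 2).
  apply: ler_oppl_sqr; first by rewrite mulr_ge0 ?divr_ge0 ?sqrtr_ge0.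
  rewrite exprMn rhoE expr_div_n s3E (_ : 3 / 2 ^+ 2 = y1 ^+ 2 + y2 ^+ 2);
    last first.
    by rewrite yy; field.
  by have := sqr_ge0 (X * y2 - Y * y1); nra.
have -> : (rho + s3 / 2) ^+ 2 = rho ^+ 2 + 2 * (rho * (s3 / 2)) + s3 ^+ 2 / 4 by
  field.
rewrite rhoE s3E; lra.
Qed.

Lemma smoothing (p q r s x : E3) : regular_tetrahedron p q r s ->
  sqd x r <= 1 -> sqd x s <= 1 ->
  (forall y, opposite_arc p q r s y -> sqd x y <= 1) <->
  (bary r p q s x < 0 -> bary s p q r x < 0 -> lemon p q x <= 1).
Proof.
move=> /regular_tetrahedron_canonical [f [rf [[fp fq] [fr fs]]]] xr xs.
rewrite -!(bary_rigid _ _ _ _ x rf) -(lemon_rigid _ _ x rf) fp fq fr fs.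
rewrite -can_smoothing; [|by rewrite -fr sqd_rigid|by rewrite -fs sqd_rigid].
split=> H y.
  have [z <-] : exists z, f z = y by case: rf => _ _; exact.
  rewrite /opposite_arc /= -fp -fq -fr -fs !(sqd_rigid _ _ rf); exact: H.
move=> hy; rewrite -(sqd_rigid x y rf); apply: H.
by rewrite /opposite_arc /= -fp -fq -fr -fs !(sqd_rigid _ _ rf).
Qed.

(** [lemon p q x] is the squared distance to the farthest point of the full circle carrying the
    opposite arc, and [r] and [s] lie on that circle. *)
Lemma lemon_le1 (p q r s x : E3) : regular_tetrahedron p q r s ->
  lemon p q x <= 1 -> sqd x r <= 1 /\ sqd x s <= 1.
Proof.
move=> /regular_tetrahedron_canonical [f [rf [[fp fq] [fr fs]]]].
rewrite -(lemon_rigid _ _ x rf) -(sqd_rigid x r rf) -(sqd_rigid x s rf) fp fq fr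
  fs.
rewrite /lemon can_radial can_axial /sqd /=.
set X := (f x).1.1; set Y := (f x).1.2; set Z := (f x).2.
set rho := Num.sqrt (X ^+ 2 + Y ^+ 2).
have rhoE : rho ^+ 2 = X ^+ 2 + Y ^+ 2 by rewrite sqr_sqrtr // addr_ge0
  ?sqr_ge0.
have rho0 : 0 <= rho by exact: sqrtr_ge0.
have CS (t : R) : t ^+ 2 = 1 / 4 -> - (X * (s2 / 2) + Y * t) <= rho * (s3 / 2).
  move=> t2; apply: ler_oppl_sqr; first by rewrite mulr_ge0 ?divr_ge0
    ?sqrtr_ge0.
  rewrite exprMn rhoE expr_div_n s3E (_ : 3 / 2 ^+ 2 = (s2 / 2) ^+ 2 + t ^+ 2);
    last first.
    by rewrite t2 expr_div_n s2E; field.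
  by have := sqr_ge0 (X * t - Y * (s2 / 2)); nra.
have -> : (rho + s3 / 2) ^+ 2 = rho ^+ 2 + 2 * (rho * (s3 / 2)) + s3 ^+ 2 / 4 by
  field.
have e (u v : R) : (u - s2 / 2) ^+ 2 + v = u ^+ 2 - 2 * (u * (s2 / 2)) + 1 / 2 +
  v.
  by transitivity (u ^+ 2 - s2 * u + s2 ^+ 2 / 4 + v); [field|rewrite s2E;
    field].
rewrite rhoE s3E -!addrA !e => h.
have h1 := CS (1 / 2) (ltac:(field)).
have h2 := CS (- (1 / 2)) (ltac:(field)).
by split; lra.
Qed.

End smoothing.

(** * Decomposition of the rounded bodies *)

Lemma le_lt_false (R : realType) (x : R) : 0 <= x -> x < 0 -> False.
Proof. by rewrite leNgt => /negP. Qed.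

(* [region] settles that two regions cut out by sign conditions agree at a point,
   [void] that a region beyond three faces is empty. *)
Ltac region P Q U V := move: (e2 P Q U V); move: P Q U V; clear => ? ? ? ? ?;
  move=> *; split; [tauto|let H := fresh in move=> H;
  decompose [and] H; repeat match goal with |- _ /\ _ => split end;
  first [assumption | by move=> _ *; exfalso; eapply le_lt_false; eassumption
    | lra]].

Ltac void P Q U V := move: (e2 P Q U V); move: P Q U V; clear => ? ? ? ? ?;
  let n := fresh in let k := fresh in
  move=> n [[[[[[[? ?] [? ?]] _] ?] ?] ?] ?];
  assert (k := n ltac:(assumption) ltac:(assumption) ltac:(assumption)); lra.

Section body.
Variable R : realType.
Local Notation E3 := (R * R * R)%type.
Local Notation s2 := (Num.sqrt 2 : R).
Local Notation s3 := (Num.sqrt 3 : R).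
Local Notation half := (@half_dihedral R).

Lemma tetrahedron_in_balls (a b c d : R) :
  0 <= a -> 0 <= b -> 0 <= c -> 0 <= d -> 0 <= a + e2 a b c d.
Proof. by move=> *; rewrite /e2 !addr_ge0 ?mulr_ge0. Qed.

(** With [d] eliminated, [e2] is [a + b + c] minus [a^2 + b^2 + c^2 + a b + a c + b c]. A point
    beyond three faces thus violates [0 <= a + e2], a ball condition. *)
Lemma e2_vertex_region_lt0 (a b c d : R) : a + b + c + d = 1 ->
  a < 0 -> b < 0 -> c < 0 -> e2 a b c d < 0.
Proof.
rewrite /e2 => s a0 b0 c0.
have -> : d = 1 - (a + b + c) by lra.
by nra.
Qed.

Lemma sqd_le1 (p q r s x : E3) : regular_tetrahedron p q r s ->
  (sqd x p <= 1) = (0 <= bary p q r s x + e2 (bary p q r s x) (bary q p r s x)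
    (bary r p q s x) (bary s p q r x)).
Proof.
move=> t; rewrite (sqd_bary x t).
set c := bary p q r s x; set e := e2 _ _ _ _; apply/idP/idP; lra.
Qed.

Definition cap_volume : R := 2 * half - pi / 3 - s2 / 12.

Lemma measurable_bary_ge0 (p q r s : E3) : measurable [set x | 0 <= bary p q r s
  x].
Proof. exact: (measurable_ler_set (measurable_cst _) (measurable_bary _ _ _ _)).
  Qed.

Lemma measurable_bary_lt0 (p q r s : E3) : measurable [set x | bary p q r s x <
  0].
Proof. exact: (measurable_ltr_set (measurable_bary _ _ _ _) (measurable_cst _)).
  Qed.

Lemma measurable_unit_ball (p : E3) : measurable [set x | sqd x p <= 1].
Proof. exact: (measurable_ler_set (measurable_sqd _) (measurable_cst _)). Qed.

Lemma volume_cap (p q r s : E3) : regular_tetrahedron p q r s ->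
  volume [set x : E3 | bary p q r s x < 0 /\ (0 <= bary q p r s x /\
    (0 <= bary r p q s x /\ (0 <= bary s p q r x /\ sqd x p <= 1)))]
  = cap_volume%:E.
Proof.
move=> t; have := volume_sector t; set S := (X in volume X).
have mS : measurable S.
  do 3 (apply: measurableI; last exact: measurable_bary_ge0).
  exact: measurable_unit_ball.
rewrite (volume_split (measurable_bary p q r s) mS).
rewrite [X in (volume X + _)%E](_ : _ =
  [set x : E3 | (0 <= bary p q r s x /\ 0 <= bary q p r s x) /\
                  (0 <= bary r p q s x /\ 0 <= bary s p q r x)]); last first.
  apply/seteqP; split => x /=; first by move=> [[[[? ?] ?] ?] ?].
  move=> [[hp hq] [hr hs]]; do 4 (split => //).
  by rewrite /mkset (sqd_le1 x t); exact: tetrahedron_in_balls.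
rewrite (volume_tetrahedron t).
rewrite [X in (_ + volume X)%E](_ : _ =
  [set x : E3 | bary p q r s x < 0 /\ (0 <= bary q p r s x /\
    (0 <= bary r p q s x /\ (0 <= bary s p q r x /\ sqd x p <= 1)))]);
      last first.
  by apply/seteqP; split => x; rewrite /S /=; tauto.
move: (volume _) => [v| |] //; rewrite -EFinD => -[h].
by congr (_%:E); rewrite /cap_volume -h; ring.
Qed.

Definition edge_volume (c : bool) : R :=
  if c then half * (11 / 12 - s3 * pi / 6)
  else 2 * (pi / 3 + s2 / 24 - 43 / 24 * half).

(** By [smoothing], inside the balls about [r] and [s] this is the unit distance condition for the
    arc opposite to [p q]. A false flag imposes nothing, so sharp and smoothed edges are treated
    together. *)
Definition smoothed (c : bool) (p q r s x : E3) : Prop :=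
  c -> bary r p q s x < 0 -> bary s p q r x < 0 -> lemon p q x <= 1.

Lemma measurable_smoothed c p q r s : measurable [set x | smoothed c p q r s x].
Proof.
case: c; last by rewrite (_ : [set x | _] = setT) //; apply/seteqP; split.
rewrite (_ : [set x | _] = [set x | 0 <= bary r p q s x] `|`
   ([set x | 0 <= bary s p q r x] `|` [set x | lemon p q x <= 1])).
  apply: measurableU; first exact: measurable_bary_ge0.
  apply: measurableU; first exact: measurable_bary_ge0.
  exact: (measurable_ler_set (measurable_lemon _ _) (measurable_cst _)).
apply/seteqP; split => x; rewrite /smoothed /= => h.
  have [?|hr] := leP 0 (bary r p q s x); first by left.
  have [?|hs] := leP 0 (bary s p q r x); first by right; left.
  by right; right; exact: h.
by case: h => [h|[h|h]] _ hr hs //; [move: hr|move: hs]; rewrite ltNge h.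
Qed.

Definition rounded_body (cpq cpr cps cqr cqs crs : bool) (p q r s : E3) :
  set E3 :=
  [set x | ((sqd x p <= 1 /\ sqd x q <= 1) /\ (sqd x r <= 1 /\ sqd x s <= 1)) /\
    ((smoothed cpq p q r s x /\ smoothed cpr p r q s x /\
      smoothed cps p s q r x) /\
     (smoothed cqr q r p s x /\ smoothed cqs q s p r x /\
      smoothed crs r s p q x))].

Lemma measurable_rounded_body cpq cpr cps cqr cqs crs p q r s :
  measurable (rounded_body cpq cpr cps cqr cqs crs p q r s).
Proof.
have ms := measurable_smoothed; have mu := measurable_unit_ball.
apply: measurableI.
  by apply: measurableI; apply: measurableI; exact: mu.
apply: measurableI.
  by apply: measurableI; [exact: ms|apply: measurableI; exact: ms].
by apply: measurableI; [exact: ms|apply: measurableI; exact: ms].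
Qed.


Lemma volume_edge_region (c : bool) p q r s : regular_tetrahedron p q r s ->
  volume [set x : E3 | (bary r p q s x < 0 /\ bary s p q r x < 0) /\
    ((sqd x r <= 1 /\ sqd x s <= 1) /\ smoothed c p q r s x)]
  = (edge_volume c)%:E.
Proof.
move=> t; case: c => /=.
  rewrite -(volume_edge_smoothed t); congr volume.
  apply/seteqP; split => x; rewrite /smoothed /=.
    by move=> [[h1 h2] [_ h]]; split => //; exact: h.
  by move=> [h1 h2]; split => //; split => //; exact: (lemon_le1 t).
rewrite -(volume_edge_sharp t); congr volume.
by apply/seteqP; split => x; rewrite /smoothed /=; [move=> [? []]|move=> [? ?]].
Qed.

Lemma volume_split_eq (b : E3 -> R) (A : set E3) (u v : R) :
  measurable_fun setT b -> measurable A ->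
  volume (A `&` [set x | 0 <= b x]) = u%:E ->
  volume (A `&` [set x | b x < 0]) = v%:E -> volume A = (u + v)%:E.
Proof. by move=> mb mA hu hv; rewrite (volume_split mb mA) hu hv. Qed.

Section decomposition.
Variables (cpq cpr cps cqr cqs crs : bool) (p q r s : E3).
Hypothesis t : regular_tetrahedron p q r s.

Local Notation M := (rounded_body cpq cpr cps cqr cqs crs p q r s).
Local Notation bp := (bary p q r s).
Local Notation bq := (bary q p r s).
Local Notation br := (bary r p q s).
Local Notation bs := (bary s p q r).
Local Notation sg x := (e2 (bp x) (bq x) (br x) (bs x)).
Local Notation "{+ b }" := [set x : E3 | 0 <= b x] (b at level 9).
Local Notation "{- b }" := [set x : E3 | b x < 0] (b at level 9).

Let tq := regular_swap12 t.
Let tr := regular_swap12 (regular_swap23 t).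
Let ts := regular_swap12 (regular_swap23 (regular_swap34 t)).

Lemma ball_pE x : (sqd x p <= 1) = (0 <= bp x + sg x).
Proof. exact: sqd_le1 t. Qed.

Lemma ball_qE x : (sqd x q <= 1) = (0 <= bq x + sg x).
Proof.
rewrite (sqd_le1 x tq) (baryC12 r q p) (baryC12 s q p).
by congr (0 <= _ + _); rewrite /e2; ring.
Qed.

Lemma ball_rE x : (sqd x r <= 1) = (0 <= br x + sg x).
Proof.
rewrite (sqd_le1 x tr) (baryC12 p r q) (baryC12 q r p) (baryC12 s r p).
by rewrite (baryC23 s p r); congr (0 <= _ + _); rewrite /e2; ring.
Qed.

Lemma ball_sE x : (sqd x s <= 1) = (0 <= bs x + sg x).
Proof.
rewrite (sqd_le1 x ts) (baryC12 p s q) (baryC23 p q s) (baryC12 q s p).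
rewrite (baryC23 q p s) (baryC12 r s p) (baryC23 r p s).
by congr (0 <= _ + _); rewrite /e2; ring.
Qed.

Lemma smoothed_prE x : smoothed cpr p r q s x =
  (cpr -> bq x < 0 -> bs x < 0 -> lemon p r x <= 1).
Proof. by rewrite /smoothed (baryC23 s p r). Qed.

Lemma smoothed_psE x : smoothed cps p s q r x =
  (cps -> bq x < 0 -> br x < 0 -> lemon p s x <= 1).
Proof. by rewrite /smoothed (baryC23 q p s) (baryC23 r p s). Qed.

Lemma smoothed_qrE x : smoothed cqr q r p s x =
  (cqr -> bp x < 0 -> bs x < 0 -> lemon q r x <= 1).
Proof. by rewrite /smoothed (baryC23 s q r) (baryC12 s q p). Qed.

Lemma smoothed_qsE x : smoothed cqs q s p r x =
  (cqs -> bp x < 0 -> br x < 0 -> lemon q s x <= 1).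
Proof.
by rewrite /smoothed (baryC23 p q s) (baryC23 r q s) (baryC12 r q p).
Qed.

Lemma smoothed_rsE x : smoothed crs r s p q x =
  (crs -> bp x < 0 -> bq x < 0 -> lemon r s x <= 1).
Proof.
rewrite /smoothed (baryC23 p r s) (baryC12 p r q) (baryC23 q r s).
by rewrite (baryC12 q r p).
Qed.

(** With every condition on the same four functions and their [e2], the tactic [region] can replace
    these by arbitrary reals and compare sign patterns. *)
Lemma rounded_bodyE x : M x =
  (((0 <= bp x + sg x /\ 0 <= bq x + sg x) /\
    (0 <= br x + sg x /\ 0 <= bs x + sg x)) /\
   (((cpq -> br x < 0 -> bs x < 0 -> lemon p q x <= 1) /\
     (cpr -> bq x < 0 -> bs x < 0 -> lemon p r x <= 1) /\
     (cps -> bq x < 0 -> br x < 0 -> lemon p s x <= 1)) /\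
    ((cqr -> bp x < 0 -> bs x < 0 -> lemon q r x <= 1) /\
     (cqs -> bp x < 0 -> br x < 0 -> lemon q s x <= 1) /\
     (crs -> bp x < 0 -> bq x < 0 -> lemon r s x <= 1)))).
Proof.
rewrite /rounded_body /mkset ball_pE ball_qE ball_rE ball_sE.
by rewrite smoothed_prE smoothed_psE smoothed_qrE smoothed_qsE smoothed_rsE.
Qed.

Lemma vertex_s_lt0 x : bp x < 0 -> bq x < 0 -> br x < 0 -> sg x < 0.
Proof.
by move=> hp hq hr; apply: e2_vertex_region_lt0 => //; exact: bary_sum.
Qed.

Lemma vertex_r_lt0 x : bp x < 0 -> bq x < 0 -> bs x < 0 -> sg x < 0.
Proof.
move=> hp hq hs.
rewrite (_ : sg x = e2 (bp x) (bq x) (bs x) (br x)); last by rewrite /e2; ring.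
by apply: e2_vertex_region_lt0 => //; have := bary_sum p q r s x; lra.
Qed.

Lemma vertex_q_lt0 x : bp x < 0 -> br x < 0 -> bs x < 0 -> sg x < 0.
Proof.
move=> hp hr hs.
rewrite (_ : sg x = e2 (bp x) (br x) (bs x) (bq x)); last by rewrite /e2; ring.
by apply: e2_vertex_region_lt0 => //; have := bary_sum p q r s x; lra.
Qed.

Lemma vertex_p_lt0 x : bq x < 0 -> br x < 0 -> bs x < 0 -> sg x < 0.
Proof.
move=> hq hr hs.
rewrite (_ : sg x = e2 (bq x) (br x) (bs x) (bp x)); last by rewrite /e2; ring.
by apply: e2_vertex_region_lt0 => //; have := bary_sum p q r s x; lra.
Qed.

Lemma inner_ge0 x : 0 <= bp x -> 0 <= bq x -> 0 <= br x -> 0 <= bs x ->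
  0 <= sg x.
Proof.
move: (bp x) (bq x) (br x) (bs x) => a b c d *.
by rewrite /e2 !addr_ge0 ?mulr_ge0.
Qed.

Lemma eq_volume (A B : set E3) (v : R) : volume B = v%:E ->
  (forall x, A x <-> B x) -> volume A = v%:E.
Proof. by move=> <- AB; congr volume; apply/seteqP; split => x /AB. Qed.

Lemma volume_empty (A : set E3) : (forall x, A x -> False) -> volume A = 0%:E.
Proof.
move=> hA; have -> : A = set0 by apply/seteqP; split => x // /hA.
exact: (@measure0 _ _ _ (@area R \x (@lebesgue_measure R))%E).
Qed.

Lemma volume_inner : volume (M `&` {+ bp} `&` {+ bq} `&` {+ br} `&` {+ bs}) =
  (s2 / 12)%:E.
Proof.
apply: eq_volume (volume_tetrahedron t) _ => x; rewrite /= rounded_bodyE.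
have := @inner_ge0 x; region (bp x) (bq x) (br x) (bs x).
Qed.

(** When only [bs] is negative, its ball condition forces [e2 > 0], so the other three balls are
    automatic. *)
Lemma volume_cap_s : volume (M `&` {+ bp} `&` {+ bq} `&` {+ br} `&` {- bs}) =
  (cap_volume)%:E.
Proof.
apply: eq_volume (volume_cap ts) _ => x; rewrite /= rounded_bodyE (baryC12 p s
  q) (baryC23 p q s) (baryC12 q s p) (baryC23 q p s) (baryC12 r s p) (baryC23 r
  p s) ball_sE.
region (bp x) (bq x) (br x) (bs x).
Qed.

Lemma volume_cap_r : volume (M `&` {+ bp} `&` {+ bq} `&` {- br} `&` {+ bs}) =
  (cap_volume)%:E.
Proof.
apply: eq_volume (volume_cap tr) _ => x; rewrite /= rounded_bodyE (baryC12 p r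
  q) (baryC12 q r p) (baryC12 s r p) (baryC23 s p r) ball_rE.
region (bp x) (bq x) (br x) (bs x).
Qed.

(** The balls about [r] and [s] force [e2 > 0]. Hence [bp] and [bq] cannot be negative, by the
    vertex lemmas, and the balls about [p] and [q] are automatic. *)
Lemma volume_edge_pq : volume (M `&` {+ bp} `&` {+ bq} `&` {- br} `&` {- bs}) =
  (edge_volume cpq)%:E.
Proof.
apply: eq_volume (volume_edge_region cpq t) _ => x;
  rewrite /= rounded_bodyE ball_rE ball_sE /smoothed.
have := @vertex_q_lt0 x; have := @vertex_p_lt0 x; region (bp x) (bq x) (br x)
  (bs x).
Qed.

Lemma volume_cap_q : volume (M `&` {+ bp} `&` {- bq} `&` {+ br} `&` {+ bs}) =
  (cap_volume)%:E.
Proof.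
apply: eq_volume (volume_cap tq) _ => x; rewrite /= rounded_bodyE (baryC12 r q
  p) (baryC12 s q p) ball_qE.
region (bp x) (bq x) (br x) (bs x).
Qed.

Lemma volume_edge_pr : volume (M `&` {+ bp} `&` {- bq} `&` {+ br} `&` {- bs}) =
  (edge_volume cpr)%:E.
Proof.
apply: eq_volume (volume_edge_region cpr (regular_swap23 t)) _ => x;
  rewrite /= rounded_bodyE smoothed_prE (baryC23 s p r) ball_qE ball_sE.
have := @vertex_r_lt0 x; have := @vertex_p_lt0 x; region (bp x) (bq x) (br x)
  (bs x).
Qed.

Lemma volume_edge_ps : volume (M `&` {+ bp} `&` {- bq} `&` {- br} `&` {+ bs}) =
  (edge_volume cps)%:E.
Proof.
apply: eq_volume (volume_edge_region cps (regular_swap23 (regular_swap34 t))) _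
  => x; rewrite /= rounded_bodyE smoothed_psE (baryC23 q p s) (baryC23 r p s)
  ball_qE ball_rE.
have := @vertex_s_lt0 x; have := @vertex_p_lt0 x; region (bp x) (bq x) (br x)
  (bs x).
Qed.

Lemma volume_cap_p : volume (M `&` {- bp} `&` {+ bq} `&` {+ br} `&` {+ bs}) =
  (cap_volume)%:E.
Proof.
apply: eq_volume (volume_cap t) _ => x; rewrite /= rounded_bodyE ball_pE.
region (bp x) (bq x) (br x) (bs x).
Qed.

Lemma volume_edge_qr : volume (M `&` {- bp} `&` {+ bq} `&` {+ br} `&` {- bs}) =
  (edge_volume cqr)%:E.
Proof.
apply: eq_volume (volume_edge_region cqr (regular_swap23 tq)) _ => x;
  rewrite /= rounded_bodyE smoothed_qrE (baryC23 s q r) (baryC12 s q p) ball_pE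
  ball_sE.
have := @vertex_r_lt0 x; have := @vertex_q_lt0 x; region (bp x) (bq x) (br x)
  (bs x).
Qed.

Lemma volume_edge_qs : volume (M `&` {- bp} `&` {+ bq} `&` {- br} `&` {+ bs}) =
  (edge_volume cqs)%:E.
Proof.
apply: eq_volume (volume_edge_region cqs (regular_swap23 (regular_swap34 tq))) _
  => x; rewrite /= rounded_bodyE smoothed_qsE (baryC23 p q s) (baryC23 r q s)
  (baryC12 r q p) ball_pE ball_rE.
have := @vertex_s_lt0 x; have := @vertex_q_lt0 x; region (bp x) (bq x) (br x)
  (bs x).
Qed.

Lemma volume_edge_rs : volume (M `&` {- bp} `&` {- bq} `&` {+ br} `&` {+ bs}) =
  (edge_volume crs)%:E.
Proof.
apply: eq_volume (volume_edge_region crs (regular_swap23 (regular_swap34 tr))) _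
  => x; rewrite /= rounded_bodyE smoothed_rsE (baryC23 p r s) (baryC12 p r q)
  (baryC23 q r s) (baryC12 q r p) ball_pE ball_qE.
have := @vertex_r_lt0 x; have := @vertex_s_lt0 x; region (bp x) (bq x) (br x)
  (bs x).
Qed.

Lemma volume_vertex_p : volume (M `&` {+ bp} `&` {- bq} `&` {- br} `&` {- bs}) =
  0%:E.
Proof.
apply: volume_empty => x; rewrite /= rounded_bodyE; have := @vertex_p_lt0 x.
void (bp x) (bq x) (br x) (bs x).
Qed.

Lemma volume_vertex_q : volume (M `&` {- bp} `&` {+ bq} `&` {- br} `&` {- bs}) =
  0%:E.
Proof.
apply: volume_empty => x; rewrite /= rounded_bodyE; have := @vertex_q_lt0 x.
void (bp x) (bq x) (br x) (bs x).
Qed.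

Lemma volume_vertex_r : volume (M `&` {- bp} `&` {- bq} `&` {+ br} `&` {- bs}) =
  0%:E.
Proof.
apply: volume_empty => x; rewrite /= rounded_bodyE; have := @vertex_r_lt0 x.
void (bp x) (bq x) (br x) (bs x).
Qed.

Lemma volume_vertex_s : volume (M `&` {- bp} `&` {- bq} `&` {- br} `&` {+ bs}) =
  0%:E.
Proof.
apply: volume_empty => x; rewrite /= rounded_bodyE; have := @vertex_s_lt0 x.
void (bp x) (bq x) (br x) (bs x).
Qed.

Lemma volume_vertex_none : volume (M `&` {- bp} `&` {- bq} `&` {- br} `&` {-
  bs}) = 0%:E.
Proof.
apply: volume_empty => x; rewrite /= rounded_bodyE; have := @vertex_s_lt0 x.
void (bp x) (bq x) (br x) (bs x).
Qed.

Lemma volume_rounded_body : volume M =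
  (s2 / 12 + 4 * cap_volume + (edge_volume cpq + edge_volume cpr +
    edge_volume cps + edge_volume cqr + edge_volume cqs + edge_volume crs))%:E.
Proof.
(* The sum is bracketed like the tree of splits by the signs of [bp], [bq], [br], [bs]; the zeros
   stand for three or four negative signs. *)
rewrite (_ : _ + _ = (((s2 / 12 + cap_volume) + (cap_volume + edge_volume cpq))
  +
  ((cap_volume + edge_volume cpr) + (edge_volume cps + 0))) +
  (((cap_volume + edge_volume cqr) + (edge_volume cqs + 0)) +
  ((edge_volume crs + 0) + (0 + 0)))); last by ring.
have mb := @measurable_bary R; have mM : measurable M.
  exact: measurable_rounded_body.
have mP := @measurable_bary_ge0; have mN := @measurable_bary_lt0.
have mI (A B : set E3) : measurable A -> measurable B -> measurable (A `&` B).
  exact: measurableI.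
apply: (volume_split_eq (mb p q r s) mM).
- apply: (volume_split_eq (mb q p r s)); first by auto.
  + apply: (volume_split_eq (mb r p q s)); first by auto.
    * apply: (volume_split_eq (mb s p q r)); first by auto.
        exact: volume_inner.
      exact: volume_cap_s.
    * apply: (volume_split_eq (mb s p q r)); first by auto.
        exact: volume_cap_r.
      exact: volume_edge_pq.
  + apply: (volume_split_eq (mb r p q s)); first by auto.
    * apply: (volume_split_eq (mb s p q r)); first by auto.
        exact: volume_cap_q.
      exact: volume_edge_pr.
    * apply: (volume_split_eq (mb s p q r)); first by auto.
        exact: volume_edge_ps.
      exact: volume_vertex_p.
- apply: (volume_split_eq (mb q p r s)); first by auto.
  + apply: (volume_split_eq (mb r p q s)); first by auto.
    * apply: (volume_split_eq (mb s p q r)); first by auto.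
        exact: volume_cap_p.
      exact: volume_edge_qr.
    * apply: (volume_split_eq (mb s p q r)); first by auto.
        exact: volume_edge_qs.
      exact: volume_vertex_q.
  + apply: (volume_split_eq (mb r p q s)); first by auto.
    * apply: (volume_split_eq (mb s p q r)); first by auto.
        exact: volume_edge_rs.
      exact: volume_vertex_r.
    * apply: (volume_split_eq (mb s p q r)); first by auto.
        exact: volume_vertex_s.
      exact: volume_vertex_none.
Qed.

End decomposition.

End body.

(** * Edges and boundaries *)

Section bridge.
Variable R : realType.
Local Notation E3 := (R * R * R)%type.
Local Notation s2 := (Num.sqrt 2 : R).
Local Notation s3 := (Num.sqrt 3 : R).

Lemma enorm_sqd (x y : E3) : enorm (y - x) = Num.sqrt (sqd y x).
Proof. by []. Qed.

Lemma unit_ballE (x y : E3) : unit_ball x y <-> sqd y x <= 1.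
Proof.
rewrite /unit_ball /= enorm_sqd; split => h.
  rewrite leNgt; apply/negP => h'; move: h; rewrite leNgt -{1}sqrtr1.
  by rewrite ltr_sqrt ?h' // (lt_trans _ h').
by rewrite -sqrtr1 ler_wsqrtr.
Qed.

Lemma continuous_sqd (a : E3) : continuous (fun x : E3 => sqd x a).
Proof.
move=> x; rewrite /sqd.
have c1 : continuous (fun x : E3 => x.1.1).
  by move=> y; apply: (@continuous_comp _ _ _ (@fst (R * R)%type R) (@fst R R));
    exact: cvg_fst.
have c2 : continuous (fun x : E3 => x.1.2).
  move=> y; apply: (@continuous_comp _ _ _ (@fst (R * R)%type R) (@snd R R)).
    exact: cvg_fst.
  exact: cvg_snd.
have c3 : continuous (fun x : E3 => x.2) by move=> y; exact: cvg_snd.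
have sq (f : E3 -> R) (c : R) : continuous f -> continuous (fun x =>
  (f x - c) ^+ 2).
  move=> cf y; apply: (@continuous_comp _ _ _ (fun x => f x - c) (fun t =>
    t ^+ 2)).
    by apply: cvgB; [exact: cf|exact: cvg_cst].
  exact: exprn_continuous.
apply: cvgD; last exact: sq.
by apply: cvgD; exact: sq.
Qed.

Lemma boundary_unit_ball (a y : E3) : boundary (unit_ball a) y <-> sqd y a = 1.
Proof.
have cs := @continuous_sqd a.
have cl : closed (unit_ball a).
  rewrite (_ : unit_ball a = (fun x => sqd x a) @^-1` [set t | t <= 1]).
    by apply: closed_comp => [z _|]; [exact: cs|exact: closed_le].
  by apply/seteqP; split => z /unit_ballE.
rewrite /boundary -(closure_id _).1 //; split.
  move=> [/unit_ballE h1 h2]; apply/eqP; rewrite eq_le h1 leNgt; apply/negP =>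
    h3.
  have : nbhs y [set z | sqd z a < 1].
    apply: open_nbhs_nbhs; split => //.
    rewrite (_ : [set z | _] = (fun x => sqd x a) @^-1` [set t | t < 1]) //.
    by apply: open_comp => [z _|]; [exact: cs|exact: open_lt].
  move=> hn; apply: h2; apply: filterS hn => z /= /ltW ?; exact/unit_ballE.
move=> h; split; first by apply/unit_ballE; rewrite h.
move=> hi.
(* Moves [y] radially outwards, leaving the ball for every [t > 0], so [y] is not interior. *)
pose g (t : R) : E3 := ((y.1.1 + t * (y.1.1 - a.1.1),
  y.1.2 + t * (y.1.2 - a.1.2)),
  y.2 + t * (y.2 - a.2)).
have cg : {for 0, continuous g}.
  have l (u v : R) : {for 0, continuous (fun t : R => u + t * v)}.
    apply: cvgD; first exact: cvg_cst.
    by apply: cvgM; [exact: cvg_id|exact: cvg_cst].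
  exact: (cvg_pair (cvg_pair (l y.1.1 (y.1.1 - a.1.1)) (l y.1.2 (y.1.2 -
    a.1.2)))
    (l y.2 (y.2 - a.2))).
have g0 : g 0 = y by rewrite /g !mul0r !addr0; case: (y) => [[? ?] ?].
have gE t : sqd (g t) a = (1 + t) ^+ 2.
  transitivity ((1 + t) ^+ 2 * sqd y a); last by rewrite h mulr1.
  by rewrite /sqd /g /=; ring.
have : nbhs (0 : R) (g @^-1` unit_ball a) by apply: cg; rewrite g0; exact: hi.
move=> /nbhs_ballP[e /= e0 he].
have : sqd (g (e / 2)) a <= 1.
  apply/unit_ballE/he; rewrite /ball /= sub0r normrN ger0_norm; lra.
by rewrite gE; nra.
Qed.

Lemma ball_interE (S : set E3) x :
  ball_inter S x <-> forall y, S y -> sqd x y <= 1.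
Proof. by split=> H y Sy; [apply/unit_ballE|apply/unit_ballE]; exact: H. Qed.

Lemma reuleauxE (a : 'I_4 -> E3) x : reuleaux a x <-> forall k,
  sqd x (a k) <= 1.
Proof.
rewrite /reuleaux; split => [/ball_interE H k|H]; first by apply: H; exists k.
by apply/ball_interE => _ [k _ <-].
Qed.

Lemma edgeE (a : 'I_4 -> E3) (i j k l : 'I_4) :
  (forall m, [|| m == i, m == j, m == k | m == l]) ->
  k != i -> k != j -> l != i -> l != j ->
  edge a i j = opposite_arc (a k) (a l) (a i) (a j).
Proof.
move=> cov ki kj li lj; apply/seteqP; split => y /=.
  move=> [H /reuleauxE Hr]; split; last by split; exact: Hr.
  by split; apply/boundary_unit_ball/H.
move=> [[hk hl] [hi hj]]; split.
  move=> m /= [mi mj]; apply/boundary_unit_ball.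
  by have := cov m; rewrite (negPf mi) (negPf mj) /= => /orP[] /eqP ->.
apply/reuleauxE => m.
by have := cov m => /or4P[] /eqP -> //; [rewrite hk|rewrite hl].
Qed.

Lemma I4_cover (m : 'I_4) : [|| m == 0, m == 1, m == 2 | m == 3].
Proof. by case: m => [[|[|[|[|]]]]]. Qed.

Lemma unit_tetrahedron_regular (a : 'I_4 -> E3) : unit_tetrahedron a ->
  regular_tetrahedron (a 0) (a 1) (a 2) (a 3).
Proof.
move=> ha; have d (i j : 'I_4) : i != j -> sqd (a i) (a j) = 1.
  move=> ij; have := ha i j ij; rewrite enorm_sqd => h.
  rewrite -(@sqr_sqrtr _ (sqd _ _)) ?h ?expr1n //.
  by rewrite /sqd !addr_ge0 ?sqr_ge0.
by split; split; [|split| |split]; exact: d.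
Qed.

(** Since vertices lie on the arcs, the intersection of balls over arcs already satisfies the vertex
    conditions that [smoothing] assumes. *)
Lemma opposite_arc_endpoints (p q r s : E3) : regular_tetrahedron p q r s ->
  opposite_arc p q r s r /\ opposite_arc p q r s s.
Proof.
move=> [[pq [pr ps]] [qr [qs rs]]].
have self (x : E3) : sqd x x <= 1 by rewrite /sqd !subrr expr0n /= !addr0.
rewrite /opposite_arc /= (sqdC r p) (sqdC r q) (sqdC s p) (sqdC s q) (sqdC s r).
by rewrite pr ps qr qs rs !self lexx.
Qed.

(** The [sqrt 2] terms cancel as [1/12 - 4/12 + 6/24], the bare multiples of [half] as
    [8 + 11/4 - 43/4]. *)
Lemma body_value :
  s2 / 12 + 4 * cap_volume R + (3 * edge_volume R true + 3 * edge_volume R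
    false)
  = pi * (2 / 3 - s3 / 4 * acos (1 / 3)).
Proof.
by rewrite acos_dihedral /cap_volume /edge_volume; field.
Qed.

End bridge.

Theorem propositionA7 (R : realType) (a : 'I_4 -> R * R * R)
    (ha : unit_tetrahedron a) :
  volume (meissner_face a)
    = (pi * (2 / 3 - Num.sqrt 3 / 4 * acos (1 / 3)))%:E /\
  volume (meissner_vertex a)
    = (pi * (2 / 3 - Num.sqrt 3 / 4 * acos (1 / 3)))%:E.
Proof.
have t := unit_tetrahedron_regular ha.
set p := a 0 in t; set q := a 1 in t; set r := a 2 in t; set s := a 3 in t.
have e01 : edge a 0 1 = opposite_arc r s p q.
  by apply: edgeE => // m; have := I4_cover m.
have e02 : edge a 0 2 = opposite_arc q s p r.
  by apply: edgeE => // m; have := I4_cover m; do 4 case: eqP => //.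
have e03 : edge a 0 3 = opposite_arc q r p s.
  by apply: edgeE => // m; have := I4_cover m; do 4 case: eqP => //.
have e12 : edge a 1 2 = opposite_arc p s q r.
  by apply: edgeE => // m; have := I4_cover m; do 4 case: eqP => //.
have e13 : edge a 1 3 = opposite_arc p r q s.
  by apply: edgeE => // m; have := I4_cover m; do 4 case: eqP => //.
have e23 : edge a 2 3 = opposite_arc p q r s.
  by apply: edgeE => // m; have := I4_cover m; do 4 case: eqP => //.
have tq := regular_swap12 t; have t23 := regular_swap23 t.
have tqr := regular_swap23 tq.
have tqs := regular_swap23 (regular_swap34 tq).
have tps := regular_swap23 (regular_swap34 t).
have trs := regular_swap23 (regular_swap34 (regular_swap12 t23)).
have [m1 m2] := opposite_arc_endpoints trs.
have [_ m3] := opposite_arc_endpoints tqs.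
have [_ m4] := opposite_arc_endpoints tqr.
split.
  rewrite -body_value.
  (* Balls about an arc smooth the opposite edge: the three arcs from [p] smooth the edges of the
     face [q r s]. *)
  transitivity (volume (rounded_body false false false true true true p q r s)).
    rewrite /meissner_face e01 e02 e03; congr volume.
    apply/seteqP; split => x.
      move=> /ball_interE H.
      have hp : sqd x p <= 1 by apply: H; left; left.
      have hq : sqd x q <= 1 by apply: H; left; left.
      have hr : sqd x r <= 1 by apply: H; left; right.
      have hs : sqd x s <= 1 by apply: H; right.
      split; first by [].
      split; first by [].
      split; last split; move=> _.
      - by apply/(smoothing tqr hp hs) => y hy; apply: H; right.
      - by apply/(smoothing tqs hp hr) => y hy; apply: H; left; right.
      - by apply/(smoothing trs hp hq) => y hy; apply: H; left; left.
    move=> [[[hp hq] [hr hs]] [_ [h1 [h2 h3]]]]; apply/ball_interE =>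
      y [[hy|hy]|hy].
    - exact: (smoothing trs hp hq).2 (h3 isT) y hy.
    - exact: (smoothing tqs hp hr).2 (h2 isT) y hy.
    - exact: (smoothing tqr hp hs).2 (h1 isT) y hy.
  by rewrite (volume_rounded_body _ _ _ _ _ _ t); congr (_%:E); ring.
rewrite -body_value.
(* Conversely, the arcs of the face [q r s] smooth the three edges at [p]; they contain [q], [r],
   [s] but not [p], whose ball is listed separately. *)
transitivity (volume (rounded_body true true true false false false p q r s)).
  have [n1 n2] := opposite_arc_endpoints tps.
  have [_ n3] := opposite_arc_endpoints t23.
  rewrite /meissner_vertex e12 e13 e23; congr volume.
  apply/seteqP; split => x.
    move=> /ball_interE H.
    have hp : sqd x p <= 1 by apply: H; left; left; left.
    have hq : sqd x q <= 1 by apply: H; left; left; right.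
    have hr : sqd x r <= 1 by apply: H; left; left; right.
    have hs : sqd x s <= 1 by apply: H; left; right.
    split; first by [].
    split; last by [].
    split; last split; move=> _.
    - by apply/(smoothing t hr hs) => y hy; apply: H; right.
    - by apply/(smoothing t23 hq hs) => y hy; apply: H; left; right.
    - by apply/(smoothing tps hq hr) => y hy; apply: H; left; left; right.
  move=> [[[hp hq] [hr hs]] [[h1 [h2 h3]] _]].
  apply/ball_interE => y [[[->|hy]|hy]|hy] //.
  - exact: (smoothing tps hq hr).2 (h3 isT) y hy.
  - exact: (smoothing t23 hq hs).2 (h2 isT) y hy.
  - exact: (smoothing t hr hs).2 (h1 isT) y hy.
by rewrite (volume_rounded_body _ _ _ _ _ _ t); congr (_%:E); ring.
Qed.
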